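(* There exists an absolute constant $C>0$ such that for every $n\geq 1$ and every isotropic log-concave probability measure $\mu$ on $\mathbb{R}^n$, $$\Gamma(\mu)\leq C n^{3/2}.$$ Equivalently, $\mu^+(\partial A)\leq Cn^{3/2}$ for every convex body $A\subset\mathbb{R}^n$.
   Context: A convex body is a compact convex set with nonempty interior. $B_2^n$ is the Euclidean unit ball. For a Borel probability measure $\mu$ on $\mathbb{R}^n$ and a convex body $A$, the $\mu$-perimeter is $\mu^+(\partial A)=\liminf_{\epsilon\to0^+}\frac{\mu((A+\epsilon B_2^n)\setminus A)}{\epsilon}$; when $\mu$ has a density $f$ this equals $\int_{\partial A} f\,d\lambda$, with $\lambda$ the $(n-1)$-dimensional Hausdorff measure. The maximal perimeter constant is $\Gamma(\mu)=\sup\{\mu^+(\partial A): A\subset\mathbb{R}^n \text{ a convex body}\}$. A probability measure $\mu$ on $\mathbb{R}^n$ is log-concave and full-dimensional if it has a density $f$ with $\ln f(\tau x+(1-\tau)y)\geq \tau\ln f(x)+(1-\tau)\ln f(y)$ for all $x,y$ and $\tau\in[0,1]$. It is isotropic if its barycenter $\int x f(x)\,dx$ is $0$ and its covariance matrix $\int x x^{T} f(x)\,dx$ is the identity. *)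

(* Defs.v *)
From mathcomp Require Import all_boot all_algebra all_classical all_reals all_analysis.
Import GRing.Theory Num.Theory numFieldNormedType.Exports.
Set Implicit Arguments. Unset Strict Implicit. Unset Printing Implicit Defensive.
Local Open Scope classical_set_scope.
Local Open Scope ring_scope.

(* Points of R^n are row vectors 'rV[R]_n (product topology = Euclidean topology). *)

Definition enorm (R : realType) (n : nat) (x : 'rV[R]_n) : R :=
  Num.sqrt (\sum_(i < n) x ord0 i ^+ 2).

Definition eball (R : realType) (n : nat) : set 'rV[R]_n :=
  [set x | enorm x <= 1].

Definition parallel_body (R : realType) (n : nat) (A : set 'rV[R]_n) (e : R)
  : set 'rV[R]_n :=
  [set x | exists a b, A a /\ eball b /\ x = a + e *: b].

Definition convex_set_rV (R : realType) (n : nat) (A : set 'rV[R]_n) : Prop :=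
  forall x y t, A x -> A y -> 0 <= t <= 1 -> A (t *: x + (1 - t) *: y).

Definition convex_body (R : realType) (n : nat) (A : set 'rV[R]_n) : Prop :=
  [/\ compact A, convex_set_rV A & interior A !=set0].

Definition borel_rV (R : realType) (n : nat) (A : set 'rV[R]_n) : Prop :=
  <<s (@open 'rV[R]_n) >> A.

Definition borel_fun (R : realType) (n : nat) (f : 'rV[R]_n -> R) : Prop :=
  forall B : set R, open B -> borel_rV (f @^-1` B).

(* Integral over R^n of a nonnegative function, as the iterated integral
   against the one-dimensional Lebesgue measure (equal to the integral
   against n-dimensional Lebesgue measure for Borel functions, by Tonelli). *)
Fixpoint iint (R : realType) (n : nat) : ('rV[R]_n -> \bar R) -> \bar R :=
  match n return ('rV[R]_n -> \bar R) -> \bar R with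
  | 0%N => fun g => g 0
  | n'.+1 => fun g =>
      (\int[@lebesgue_measure R]_x iint (fun y : 'rV[R]_n' => g (row_mx (\row_(_ < 1) x) y)))%E
  end.

Definition sint (R : realType) (n : nat) (g : 'rV[R]_n -> R) : \bar R :=
  (iint (fun x => (Num.max (g x) 0)%:E) - iint (fun x => (Num.max (- g x) 0)%:E))%E.

Definition dmeasure (R : realType) (n : nat) (f : 'rV[R]_n -> R) (S : set 'rV[R]_n)
  : \bar R := iint (fun x => (\1_S x * f x)%:E).

(* Log-concave probability density (full-dimensional log-concave probability
   measure given by its density): f >= 0, total mass 1, and
   ln f (t x + (1-t) y) >= t ln f x + (1-t) ln f y (with ln 0 = -oo),
   i.e. f (t x + (1-t) y) >= f x ^ t * f y ^ (1-t). *)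
Definition logconcave_prob_density (R : realType) (n : nat) (f : 'rV[R]_n -> R) : Prop :=
  [/\ forall x, 0 <= f x,
      iint (fun x => (f x)%:E) = 1%E &
      forall x y t, 0 <= t <= 1 ->
        f x `^ t * f y `^ (1 - t) <= f (t *: x + (1 - t) *: y)].

Definition isotropic_density (R : realType) (n : nat) (f : 'rV[R]_n -> R) : Prop :=
  (forall i : 'I_n, sint (fun x => x ord0 i * f x) = 0%E) /\
  (forall i j : 'I_n, sint (fun x => x ord0 i * x ord0 j * f x) = ((i == j)%:R)%:E).

Definition perimeter (R : realType) (n : nat) (f : 'rV[R]_n -> R) (A : set 'rV[R]_n)
  : \bar R :=
  ereal_sup [set ereal_inf [set (dmeasure f (parallel_body A e `\` A) * (e^-1)%:E)%E
                           | e in [set e : R | 0 < e < d]]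
            | d in [set d : R | 0 < d]].

Definition Gamma (R : realType) (n : nat) (f : 'rV[R]_n -> R) : \bar R :=
  ereal_sup [set perimeter f A | A in [set A : set 'rV[R]_n | convex_body A]].

(* Main.v *)
Require Import Defs.
From HB Require Import structures.
From mathcomp Require Import all_boot all_order all_algebra all_classical all_reals all_analysis.
From mathcomp Require Import finmap measurable_realfun zify ring lra.
Import Order.TTheory GRing.Theory Num.Theory numFieldNormedType.Exports.
Set Implicit Arguments.
Unset Strict Implicit.
Unset Printing Implicit Defensive.
Local Open Scope classical_set_scope.
Local Open Scope ring_scope.

(** Let M = sup f. On the convex set K = {f >= 2^(-82 n) M} isotropy forces a width
    r ~ n^(-1/2) in every direction u: if r - <u, x> >= 0 on K, then r - <u, x> is
    O(n r) on K by contracting the density towards a point of K, and the part of f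
    outside K is negligible, so its second moment 1 + r^2 would be O(n r^2).

    By compactness finitely many points q of K, recentred at a point p of K close to
    the origin, give a finite set S of vectors s = (2/r)(q - p) such that every g
    satisfies <g, s> >= |g| for some s in S.  Log-concavity bounds
    h(y) = min(f(y), min_s f(y + e s)) from below at contracted points, whence
    int h >= 1 - O(n e / r).

    Finally let d be the distance to A in the gauge of conv S.  Translating each x
    outside A by e s, with s in S along which d grows at full speed, is an injective
    piecewise translation of {d > 0} into {d > e}; hence the mass of {0 < d <= e},
    which contains (A + e B) \ A, is at most int f - int h = O(n e / r) = O(n^(3/2) e). *)

(** * Borel functions on row vectors and the measure behind iint *)

(** Measurability for this structure is definitionally [borel_rV], which opens the library of
    measurable functions to row vectors. *)
Notation rVb R n := (g_sigma_algebraType (@open 'rV[R]_n)).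

Section borel_rV_theory.
Context {R : realType}.

Lemma continuous_measurable_rV n (f : 'rV[R]_n -> R) :
  continuous f -> measurable_fun [set: rVb R n] f.
Proof.
move=> /continuousP cf; apply: (measurability _ (RGenOpens.measurableE R)).
move=> _ [_ [a [b ->] <-]]; rewrite setTI; apply: sub_sigma_algebra.
exact/cf/interval_open.
Qed.

Lemma borel_fun_measurable n (f : 'rV[R]_n -> R) :
  borel_fun f -> measurable_fun [set: rVb R n] f.
Proof.
move=> bf; apply: (measurability _ (RGenOpens.measurableE R)).
move=> _ [_ [a [b ->] <-]]; rewrite setTI; apply: bf; exact: interval_open.
Qed.

Lemma coord_measurable n (i : 'I_n) :
  measurable_fun [set: rVb R n] (fun x : rVb R n => (x : 'rV[R]_n) ord0 i : R).
Proof. by apply: continuous_measurable_rV; exact: coord_continuous. Qed.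

(** Boxes with rational centres and radii [1 / (k + 1)] form a countable base of the product
    topology. *)
Lemma open_rV_bigcup_box n (U : set 'rV[R]_n) : open U ->
  U = \bigcup_(p : 'rV[rat]_n * nat)
    [set x | (ball (\row_i (ratr (p.1 ord0 i) : R)) (p.2.+1%:R^-1 : R) `<=` U) /\
       forall i, ball (ratr (p.1 ord0 i) : R) (p.2.+1%:R^-1 : R) (x ord0 i)].
Proof.
move=> oU; apply/seteqP; split=> [x Ux|x [[q k] _ [/= + h]]]; last first.
  apply; split; first by rewrite invr_gt0.
  move=> i j; rewrite !mxE (ord1 i); exact: h.
have /nbhs_ballP[e /= e0 xeU] : nbhs x U by exact: open_nbhs_nbhs.
have [k ke] : exists k : nat, (k.+1%:R^-1 : R) < e / 2.
  have /ltr_add_invr[k] : (0 : R) < e / 2 by rewrite divr_gt0.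
  by rewrite add0r; exists k.
have k0 : (0 : R) < k.+1%:R^-1 by rewrite invr_gt0.
have hq (i : 'I_n) : exists q : rat, ball (x ord0 i) (k.+1%:R^-1 : R) (ratr q).
  have /rat_in_itvoo[q] : x ord0 i - k.+1%:R^-1 < x ord0 i + k.+1%:R^-1.
    by rewrite ltrD2l (lt_trans _ k0)// oppr_lt0.
  rewrite in_itv/= => /andP[q1 q2]; exists q.
  by rewrite /ball/= ltr_distlC; apply/andP.
pose q i := projT1 (cid (hq i)).
have qP i : ball (x ord0 i) (k.+1%:R^-1 : R) (ratr (q i)) := projT2 (cid (hq i)).
exists (\row_i q i, k) => //; split => /=; last first.
  by move=> i; rewrite mxE; apply: ball_sym; exact: qP.
move=> y [_ qy]; apply: xeU; split => // i j; rewrite (ord1 i).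
have -> : e = e / 2 + e / 2 by lra.
apply: (@ball_triangle _ _ (ratr (q j) : R)).
  by apply: (le_ball (ltW ke)); exact: qP.
apply: (le_ball (ltW ke)).
by have := qy ord0 j; rewrite !mxE.
Qed.

(** The preimage of an open set is a countable union, over rational boxes, of finite intersections
    of coordinate preimages. *)
Lemma measurable_fun_rV d (X : measurableType d) n (F : X -> rVb R n) :
  (forall i, measurable_fun setT (fun x => (F x : 'rV[R]_n) ord0 i : R)) ->
  measurable_fun setT F.
Proof.
move=> mF; apply: (@measurability _ _ _ (rVb R n) _ _ (@open 'rV[R]_n)) => //.
move=> _ [U oU <-]; rewrite setTI (open_rV_bigcup_box oU) preimage_bigcup.
apply: countable_bigcupT_measurable => [|[q k]]; first exact: countableP.
(* This inclusion does not involve the point; when it fails, the piece of the union is empty. *)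
have [h|h] := pselect (ball (\row_i (ratr (q ord0 i) : R)) (k.+1%:R^-1 : R) `<=` U); last first.
  rewrite (_ : _ @^-1` _ = set0) //; apply/seteqP; split => // x [].
  by move/h.
rewrite (_ : _ @^-1` _ = \big[setI/setT]_(i < n)
   ((fun x => (F x : 'rV[R]_n) ord0 i) @^-1` (ball (ratr (q ord0 i) : R) (k.+1%:R^-1 : R)))).
  apply: bigsetI_measurable => i _; rewrite -[X in measurable X]setTI.
  by apply: mF => //; exact: measurable_ball.
apply/seteqP; split => x /=.
  by case=> _ hx; rewrite -bigcap_seq/= => i _; exact: hx.
rewrite -bigcap_seq/= => hx; split => // i; apply: (hx i) => /=.
exact: mem_index_enum.
Qed.

End borel_rV_theory.

(** * Splitting off the first coordinate *)

Section row_cons.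
Context {R : realType} (n : nat).

Definition row_cons (p : measurableTypeR R * rVb R n) : rVb R n.+1 :=
  row_mx (\row_(_ < 1) (p.1 : R)) (p.2 : 'rV[R]_n).

Definition row_uncons (x : rVb R n.+1) : measurableTypeR R * rVb R n :=
  ((x : 'rV[R]_n.+1) ord0 ord0, @rsubmx _ _ 1 n x).

Lemma row_consK : cancel row_cons row_uncons.
Proof.
case=> a y; rewrite /row_uncons/row_cons/= row_mxKr; congr pair.
transitivity (row_mx (\row_(_ < 1) a) (y : 'rV[R]_n) ord0 (lshift n ord0)).
  by congr (row_mx _ _ _ _); exact/val_inj.
by rewrite row_mxEl mxE.
Qed.

Lemma row_unconsK : cancel row_uncons row_cons.
Proof.
move=> x; rewrite /row_uncons/row_cons/=.
rewrite (_ : (\row_(_ < 1) _) = @lsubmx _ 1 1 n x); first exact: (@hsubmxK R 1 1 n x).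
apply/rowP => i; rewrite !mxE (ord1 i); congr (x _ _); exact/val_inj.
Qed.

Lemma row_cons_measurable : measurable_fun setT row_cons.
Proof.
apply: measurable_fun_rV => i; rewrite /row_cons.
case: (@splitP 1 n i) => j ij.
  rewrite (_ : (fun x => _) = fst); first exact: measurable_fst.
  apply/funext => x.
  transitivity (row_mx (\row_(_ < 1) (x.1 : R)) (x.2 : 'rV[R]_n) ord0 (lshift n j)).
    by congr (row_mx _ _ _ _); exact/val_inj.
  by rewrite row_mxEl mxE.
rewrite (_ : (fun x => _) = (fun y : rVb R n => (y : 'rV[R]_n) ord0 j) \o snd).
  by apply: measurableT_comp; [exact: coord_measurable|exact: measurable_snd].
apply/funext => x.
transitivity (row_mx (\row_(_ < 1) (x.1 : R)) (x.2 : 'rV[R]_n) ord0 (rshift 1 j)).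
  by congr (row_mx _ _ _ _); exact/val_inj.
by rewrite row_mxEr.
Qed.

Lemma row_uncons_measurable : measurable_fun setT row_uncons.
Proof.
apply: measurable_fun_pair; first exact: coord_measurable.
apply: measurable_fun_rV => i.
rewrite (_ : (fun x => _) =
  (fun x : rVb R n.+1 => (x : 'rV[R]_n.+1) ord0 (rshift 1 i))).
  exact: coord_measurable.
by apply/funext => x; rewrite !mxE.
Qed.

End row_cons.

(** Induction on the dimension: a Dirac mass in dimension 0, then the image under [row_cons] of the
    product with Lebesgue measure, where Tonelli recovers the iterated integral. Sigma-finiteness is
    carried along because Tonelli requires it. *)
Lemma iint_measure_exists (R : realType) n :
  exists mu : {sigma_finite_measure set (rVb R n) -> \bar R},
    forall g : rVb R n -> \bar R, measurable_fun [set: rVb R n] g -> (forall x, (0 <= g x)%E) ->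
      iint g = (\int[mu]_x g x)%E.
Proof.
elim: n => [|n [mu muP]].
  exists (@dirac _ (rVb R 0) (0 : 'rV[R]_0) R) => g mg g0 /=.
  by rewrite integral_dirac// diracT mul1e.
have mc := @row_cons_measurable R n.
pose nu : {measure set (rVb R n.+1) -> \bar R} :=
  measure_function_pushforward__canonical__measure_function_Measure
    (@lebesgue_measure R \x mu)%E mc.
have sf : sigma_finite setT nu.
  have /sigma_finiteP[F [TF ndF Foo]] := sigma_finiteT (@lebesgue_measure R).
  have /sigma_finiteP[G [TG ndG Goo]] := sigma_finiteT mu.
  (* Products of two nondecreasing exhaustions; monotonicity lets the larger of two indices serve
     both factors. *)
  exists (fun k => @row_uncons R n @^-1` (F k `*` G k)).
    rewrite -preimage_bigcup; apply/seteqP; split => // x _.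
    have [i _ Fi] : (\bigcup_i F i) (row_uncons x).1 by rewrite -TF.
    have [j _ Gj] : (\bigcup_i G i) (row_uncons x).2 by rewrite -TG.
    exists (maxn i j) => //; split.
    - by move: Fi; exact/subsetPset/ndF/leq_maxl.
    - by move: Gj; exact/subsetPset/ndG/leq_maxr.
  move=> k; have [? ?] := Foo k; have [? ?] := Goo k; split.
    by rewrite -[X in measurable X]setTI; apply: row_uncons_measurable => //;
      exact: measurableX.
  rewrite /nu /= /pushforward -comp_preimage.
  rewrite (_ : _ \o _ = id); last by apply/funext => x; exact: row_consK.
  by rewrite preimage_id product_measure1E// lte_mul_pinfty// ge0_fin_numE.
pose sfm := Measure_isSigmaFinite.Build _ _ _ nu sf.
pose nu' : {sigma_finite_measure set (rVb R n.+1) -> \bar R} :=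
  HB.pack (Measure.sort nu) (Measure.class nu) sfm.
exists nu' => g mg g0.
rewrite /= ge0_integral_pushforward//=.
rewrite preimage_setT fubini_tonelli1//=; last exact: measurableT_comp.
apply: eq_integral => x _; rewrite muP//.
apply: (measurableT_comp mg).
exact: (measurableT_comp mc (measurable_pair1 x)).
Qed.

(** * Affine changes of variables *)

(** The integral of a nonnegative function is a supremum over simple functions below it, so the
    comparison holds for arbitrary functions. Through [le_iint] it applies to the indicator of a
    parallel body without a measurability proof. *)
Lemma ge0_le_integralT d (T : measurableType d) (R : realType)
    (mu : {measure set T -> \bar R}) (f g : T -> \bar R) :
  (forall x, 0 <= f x)%E -> (forall x, f x <= g x)%E ->
  (\int[mu]_x f x <= \int[mu]_x g x)%E.
Proof.
move=> f0 fg; have g0 x : (0 <= g x)%E by exact: le_trans (fg x).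
rewrite !ge0_integralTE//; apply: le_ereal_sup => _ [h /= hf <-].
by exists h => //= x; exact: le_trans (fg x).
Qed.

Lemma iint_ge0 (R : realType) n (g : 'rV[R]_n -> \bar R) :
  (forall x, 0 <= g x)%E -> (0 <= iint g)%E.
Proof.
by elim: n g => [|n IH] g g0 /=; [exact: g0|apply: integral_ge0 => x _; exact: IH].
Qed.

Lemma le_iint (R : realType) n (g h : 'rV[R]_n -> \bar R) :
  (forall x, 0 <= g x)%E -> (forall x, g x <= h x)%E -> (iint g <= iint h)%E.
Proof.
elim: n g h => [|n IH] g h g0 gh /=; first exact: gh.
by apply: ge0_le_integralT => x; [exact: iint_ge0|exact: IH].
Qed.

Section lebesgue_affine.
Context {R : realType} (a b : R).
Hypothesis a0 : 0 < a.

Let aff (t : measurableTypeR R) : measurableTypeR R := a * (t : R) + b.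

Let maff : measurable_fun setT aff.
Proof.
apply: measurable_funD; last exact: measurable_cst.
exact: mulrl_measurable.
Qed.

(** By uniqueness of Lebesgue measure it suffices to compare lengths of half-open intervals. *)
Lemma lebesgue_measure_affine A : measurable A ->
  ((a%:E) * pushforward (@lebesgue_measure R) aff A)%E = lebesgue_measure A.
Proof.
move=> mA; pose k := NngNum (ltW a0).
pose nu : {measure set (measurableTypeR R) -> \bar R} :=
  measure_function_pushforward__canonical__measure_function_Measure
    (@lebesgue_measure R) maff.
have -> := @lebesgue_measure_unique R (mscale k nu) _ A mA => //.
move=> _ [[x y] /= xy <-]; rewrite /mscale/= /nu/= /pushforward.
rewrite (_ : aff @^-1` _ = `](x - b) / a, (y - b) / a]%classic); last first.
  apply/seteqP; split => t /=; rewrite !in_itv/= /aff.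
    by rewrite ltr_pdivrMr// ler_pdivlMr// ltrBlDr lerBrDr (mulrC t).
  by rewrite ltr_pdivrMr// ler_pdivlMr// ltrBlDr lerBrDr (mulrC t).
rewrite !lebesgue_measure_itv/= !lte_fin ltr_pM2r ?invr_gt0// ltrD2r.
case: ifPn => _; last by rewrite mule0.
rewrite -!EFinD -EFinM; congr EFin; field; exact: lt0r_neq0.
Qed.

Lemma ge0_integral_affine (g : measurableTypeR R -> \bar R) :
  measurable_fun setT g -> (forall x, 0 <= g x)%E ->
  (\int[@lebesgue_measure R]_t g (a * t + b)%R =
   (a^-1)%:E * \int[@lebesgue_measure R]_t g t)%E.
Proof.
move=> mg g0.
pose nu : {measure set (measurableTypeR R) -> \bar R} :=
  measure_function_pushforward__canonical__measure_function_Measure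
    (@lebesgue_measure R) maff.
pose k := NngNum (ltW a0).
have := @ge0_integral_pushforward _ _ _ _ R _ maff (@lebesgue_measure R) setT g measurableT mg.
rewrite preimage_setT => /(_ (fun x _ => g0 x)) <-.
have -> : (\int[@lebesgue_measure R]_t g t = \int[mscale k nu]_t g t)%E.
  apply: eq_measure_integral => A mA _ /=.
  by rewrite /mscale/= lebesgue_measure_affine.
rewrite ge0_integral_mscale//= muleA -EFinM mulVf ?mul1e// lt0r_neq0//.
Qed.

End lebesgue_affine.

(** * Lebesgue measure on R^n under homotheties and translations *)

Section lam.
Context {R : realType}.

Definition lam n : {sigma_finite_measure set (rVb R n) -> \bar R} :=
  projT1 (cid (iint_measure_exists R n)).

Lemma iintE n (g : rVb R n -> \bar R) : measurable_fun setT g ->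
  (forall x, (0 <= g x)%E) -> iint g = (\int[lam n]_x g x)%E.
Proof. exact: projT2 (cid (iint_measure_exists R n)) g. Qed.

Lemma affine_measurable n (a : R) (b : 'rV[R]_n) :
  measurable_fun [set: rVb R n] (fun x : rVb R n => (a *: (x : 'rV[R]_n) + b : rVb R n)).
Proof.
apply: measurable_fun_rV => i.
rewrite (_ : (fun x => _) = (fun x => a * (x : 'rV[R]_n) ord0 i + b ord0 i)); last first.
  by apply/funext => x; rewrite !mxE.
apply: measurable_funD => //; apply: measurable_funM => //; exact: coord_measurable.
Qed.

(** Induction on the dimension, each coordinate contributing one factor [a^-1] by the
    one-dimensional change of variables. *)
Lemma iint_affine n (a : R) (b : 'rV[R]_n) (g : rVb R n -> \bar R) : 0 < a ->
  measurable_fun setT g -> (forall x, (0 <= g x)%E) ->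
  iint (fun x : 'rV[R]_n => g (a *: x + b)) = ((a^-1 ^+ n)%:E * iint g)%E.
Proof.
move=> a0; elim: n b g => [|n IH] b g mg g0 /=.
  by rewrite expr0 mul1e; congr g; apply/rowP; case.
pose b0 := b ord0 ord0; pose b' := @rsubmx _ 1 1 n b.
have mF : measurable_fun setT (fun x : measurableTypeR R =>
    iint (fun y : 'rV[R]_n => g (row_cons (x, y)))).
  rewrite (_ : (fun x => _) = (fun x => \int[lam n]_y g (row_cons (x, y))))%E; last first.
    apply/funext => x; rewrite iintE//; apply: (measurableT_comp mg).
    exact: (measurableT_comp (@row_cons_measurable R n) (measurable_pair1 x)).
  apply: (@measurable_fun_fubini_tonelli_F _ _ _ _ R (lam n) (g \o @row_cons R n)) => //.
  - by apply: measurableT_comp => //; exact: row_cons_measurable.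
  - by move=> x; exact: g0.
transitivity (\int[@lebesgue_measure R]_x ((a^-1 ^+ n)%:E *
    (fun t : measurableTypeR R =>
       iint (fun y : 'rV[R]_n => g (row_cons (t, y)))) (a * x + b0)%R))%E.
  apply: eq_integral => x _.
  rewrite -(IH b')//; last first.
    apply: (measurableT_comp mg).
    exact: (measurableT_comp (@row_cons_measurable R n) (measurable_pair1 _)).
  congr iint; apply/funext => y; congr g.
  rewrite -[LHS](@row_unconsK R n); congr row_cons.
  have := @row_consK R n (x, y); rewrite /row_uncons => -[hx hy].
  congr pair; first by rewrite [LHS]mxE [X in X + _]mxE hx.
  by rewrite -[y in RHS]hy; apply/rowP => i; rewrite !mxE.
rewrite ge0_integralZl//=.
- rewrite (@ge0_integral_affine R a b0 a0 _ mF); last by move=> x; exact: iint_ge0.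
  by rewrite muleA -EFinM exprSr.
- suff maff : measurable_fun [set: measurableTypeR R]
      (fun t : measurableTypeR R => a * (t : R) + b0 : measurableTypeR R).
    exact: (measurableT_comp mF maff).
  by apply: measurable_funD => //; exact: mulrl_measurable.
- by move=> x _; exact: iint_ge0.
- by rewrite lee_fin exprn_ge0// invr_ge0 ltW.
Qed.

Lemma ge0_integral_lam_affine n (a : R) (b : 'rV[R]_n) (g : rVb R n -> \bar R) : 0 < a ->
  measurable_fun setT g -> (forall x, (0 <= g x)%E) ->
  (\int[lam n]_x g (a *: (x : 'rV[R]_n) + b)%R = (a^-1 ^+ n)%:E * \int[lam n]_x g x)%E.
Proof.
move=> a0 mg g0; rewrite -!iintE//; first exact: iint_affine.
exact: (measurableT_comp mg (affine_measurable a b)).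
Qed.

End lam.

(** * The distance to a convex set in a polyhedral gauge *)

Section dot.
Context {R : realType} {n : nat}.
Implicit Types u v w x y : 'rV[R]_n.

Definition dot u v : R := \sum_(i < n) u ord0 i * v ord0 i.

Lemma dotC u v : dot u v = dot v u.
Proof. by apply: eq_bigr => i _; rewrite mulrC. Qed.

Lemma dotDl u v w : dot (u + v) w = dot u w + dot v w.
Proof. by rewrite -big_split; apply: eq_bigr => i _; rewrite mxE mulrDl. Qed.

Lemma dotZl a u w : dot (a *: u) w = a * dot u w.
Proof. by rewrite mulr_sumr; apply: eq_bigr => i _; rewrite mxE mulrA. Qed.

Lemma dotNl u w : dot (- u) w = - dot u w.
Proof. by rewrite -scaleN1r dotZl mulN1r. Qed.

Lemma dotDr u v w : dot w (u + v) = dot w u + dot w v.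
Proof. by rewrite !(dotC w) dotDl. Qed.

Lemma dotZr a u w : dot w (a *: u) = a * dot w u.
Proof. by rewrite !(dotC w) dotZl. Qed.

Lemma dotNr u w : dot w (- u) = - dot w u.
Proof. by rewrite !(dotC w) dotNl. Qed.

Definition dotE := (dotDl, dotDr, dotZl, dotZr, dotNl, dotNr).

Lemma dot0l w : dot 0 w = 0.
Proof. by rewrite -(scale0r w) dotZl mul0r. Qed.

Lemma dot_ge0 u : 0 <= dot u u.
Proof. by apply: sumr_ge0 => i _; rewrite -expr2 sqr_ge0. Qed.

Lemma enorm_ge0 u : 0 <= enorm u.
Proof. exact: sqrtr_ge0. Qed.

Lemma enormE u : enorm u = Num.sqrt (dot u u).
Proof. by congr Num.sqrt; apply: eq_bigr => i _; rewrite expr2. Qed.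

Lemma sqr_enorm u : enorm u ^+ 2 = dot u u.
Proof. by rewrite enormE sqr_sqrtr// dot_ge0. Qed.

Lemma dot_eq0 u : dot u u = 0 -> u = 0.
Proof.
move=> /eqP; rewrite psumr_eq0; last by move=> i _; rewrite -expr2 sqr_ge0.
move=> /allP h; apply/rowP => i; rewrite mxE.
by have /eqP/eqP := h i (mem_index_enum _); rewrite -expr2 sqrf_eq0 => /eqP.
Qed.

Lemma dot_gt0 u : (0 < dot u u) = (u != 0).
Proof.
rewrite lt0r dot_ge0 andbT; apply/idP/idP; apply: contra => /eqP.
  by move=> ->; rewrite dot0l.
by move=> /dot_eq0 ->.
Qed.

Lemma enorm_gt0 u : (0 < enorm u) = (u != 0).
Proof. by rewrite enormE sqrtr_gt0 dot_gt0. Qed.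

Lemma dot_le_enorm u v : dot u v <= enorm u * enorm v.
Proof.
have [->|v0] := eqVneq v 0.
  by rewrite dotC dot0l mulr_ge0// enorm_ge0.
have v1 : 0 < dot v v by rewrite dot_gt0.
apply: (le_trans (ler_norm _)).
rewrite -(@ler_pXn2r _ 2)// ?nnegrE ?mulr_ge0 ?enorm_ge0//.
rewrite real_normK ?num_real// exprMn !sqr_enorm -(ler_pM2l v1).
(* Up to the factor [dot v v], this vector is the component of [u] orthogonal to [v]. *)
have := dot_ge0 (dot v v *: u - dot u v *: v).
rewrite !dotE (dotC v u) => h.
rewrite -(ler_pM2l v1); nra.
Qed.

Lemma enorm_le_sum u : enorm u <= \sum_(i < n) `|u ord0 i|.
Proof.
have h0 : 0 <= \sum_(i < n) `|u ord0 i| by apply: sumr_ge0.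
rewrite -(@ler_pXn2r _ 2)// ?nnegrE ?enorm_ge0// sqr_enorm.
rewrite expr2 mulr_suml; apply: ler_sum => i _.
rewrite (le_trans (ler_norm _))// normrM ler_wpM2l//.
by rewrite (bigD1 i)//= lerDl sumr_ge0.
Qed.

Lemma continuous_sum_fun (I : Type) (r : seq I) (F : I -> 'rV[R]_n -> R) :
  (forall i, continuous (F i)) -> continuous (fun x => \sum_(i <- r) F i x).
Proof.
move=> cF; elim: r => [|i r IH] x.
  rewrite (_ : (fun x => _) = cst 0); first exact: cst_continuous.
  by apply/funext => y; rewrite big_nil.
rewrite (_ : (fun x => _) = F i + (fun x => \sum_(j <- r) F j x)); last first.
  by apply/funext => y; rewrite big_cons.
by apply: continuousD; [exact: cF|exact: IH].
Qed.

Lemma sum_dist_continuous x :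
  continuous (fun y : 'rV[R]_n => \sum_(i < n) `|x ord0 i - y ord0 i|).
Proof.
apply: continuous_sum_fun => i y.
apply: (@continuous_comp _ _ _ (fun y : 'rV[R]_n => x ord0 i - y ord0 i) Num.norm);
  last exact: norm_continuous.
apply: continuousB; [exact: cst_continuous|exact: coord_continuous].
Qed.

Lemma dist2_continuous x : continuous (fun y : 'rV[R]_n => dot (x - y) (x - y)).
Proof.
apply: continuous_sum_fun => i y.
have c : {for y, continuous (fun y : 'rV[R]_n => x ord0 i - y ord0 i)}.
  apply: continuousB; [exact: cst_continuous|exact: coord_continuous].
rewrite (_ : (fun y => _) =
  (fun y => x ord0 i - y ord0 i) * (fun y => x ord0 i - y ord0 i)); last first.
  by apply/funext => z; rewrite !mxE.
exact: continuousM.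
Qed.

(** The topology is the coordinatewise one, so the Euclidean distance is first bounded by the sum of
    coordinate distances, which is continuous. *)
Lemma lip_continuous (d : 'rV[R]_n -> R) :
  (forall x y, d x <= d y + enorm (x - y)) -> continuous d.
Proof.
move=> dl x; apply/(cvgrPdist_lt (FF := nbhs_filter x)) => e e0.
have /(cvgrPdist_lt (FF := nbhs_filter x))/(_ e e0) := @sum_dist_continuous x x.
apply: (@filterS _ _ (nbhs_filter x)) => y; rewrite [X in X - _]big1; last first.
  by move=> i _; rewrite subrr normr0.
rewrite sub0r normrN ger0_norm ?sumr_ge0// => h.
rewrite ltr_norml; apply/andP; split.
  have := dl y x; have := enorm_le_sum (y - x).
  rewrite (eq_bigr (fun i => `|x ord0 i - y ord0 i|)); first lra.
  by move=> i _; rewrite !mxE distrC.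
have := dl x y; have := enorm_le_sum (x - y).
rewrite (eq_bigr (fun i => `|x ord0 i - y ord0 i|)); first lra.
by move=> i _; rewrite !mxE.
Qed.

End dot.

Lemma seq_argmax (T : eqType) (R : realType) (F : T -> R) (S : seq T) x :
  x \in S -> exists2 s, s \in S & forall t, t \in S -> F t <= F s.
Proof.
elim: S x => // a S IH x _; case: S IH => [_|b S IH].
  by exists a => [|t]; rewrite inE// => /eqP ->.
have [s sS hs] := IH b (mem_head _ _).
have [as'|sa] := leP (F a) (F s).
  by exists s => [|t]; rewrite inE ?sS ?orbT// => /orP[/eqP ->|/hs].
exists a => [|t]; rewrite inE ?eqxx// => /orP[/eqP ->//|/hs].
by move=> /le_trans; apply; exact: ltW.
Qed.

(* [gdist] is the distance to A in the gauge of conv S, written by duality. *)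
Section gauge_dist.
Context {R : realType} {n : nat} (S : seq 'rV[R]_n) (A : set 'rV[R]_n).
Hypothesis HS : forall g, exists2 s, s \in S & enorm g <= dot g s.

Definition polar : set 'rV[R]_n := [set g | forall s, s \in S -> dot g s <= 1].

(** A member [v] is a gap between [x] and A certified by a functional [g] in the polar of S. The
    supremum is that of [dot g x] minus the support function of A at [g], stated without a nested
    supremum. *)
Definition gdist_set (x : 'rV[R]_n) : set R :=
  [set v | exists2 g, polar g & forall a, A a -> v <= dot g (x - a)].

Definition gdist (x : 'rV[R]_n) : R := sup (gdist_set x).

(** [HS] says that conv S contains the unit ball; hence the polar lies in the unit ball, and [gdist]
    is at most the Euclidean distance. *)
Lemma polar_enorm g : polar g -> enorm g <= 1.
Proof. by move=> pg; have [s sS h] := HS g; exact: le_trans (pg s sS). Qed.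

Lemma polar_dot g y : polar g -> dot g y <= enorm y.
Proof.
move=> /polar_enorm pg; rewrite (le_trans (dot_le_enorm _ _))//.
by rewrite ler_piMl// enorm_ge0.
Qed.

(** Dividing [g] by its maximum over S puts it on the boundary of the polar, where it takes the
    value 1 at the maximizer [s]. *)
Lemma scale_polar g : g != 0 ->
  exists2 s, s \in S & 0 < dot g s /\ polar ((dot g s)^-1 *: g).
Proof.
move=> g0; have [s1 s1S h1] := HS g.
have [s sS hs] := seq_argmax (fun s => dot g s) s1S.
have ds : 0 < dot g s.
  by rewrite (lt_le_trans _ (hs _ s1S))// (lt_le_trans _ h1)// enorm_gt0.
exists s => //; split => // t tS; rewrite dotZl -(mulVf (lt0r_neq0 ds)).
by rewrite ler_pM2l ?invr_gt0// hs.
Qed.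

Hypothesis A0 : A !=set0.

Lemma gdist_has_sup x : has_sup (gdist_set x).
Proof.
have [a Aa] := A0; split.
  by exists 0; exists 0 => [s _|b _]; rewrite dot0l ?ler01.
by exists (enorm (x - a)) => v [g pg /(_ _ Aa)] h; rewrite (le_trans h)// polar_dot.
Qed.

Lemma gdist_ub x v g : polar g -> (forall a, A a -> v <= dot g (x - a)) -> v <= gdist x.
Proof. by move=> pg h; apply: (sup_upper_bound (gdist_has_sup x)); exists g. Qed.

Lemma gdist_le x c : (forall v g, polar g ->
  (forall a, A a -> v <= dot g (x - a)) -> v <= c) -> gdist x <= c.
Proof.
move=> h; apply: ge_sup; first by have [] := gdist_has_sup x.
by move=> v [g pg hg]; exact: h hg.
Qed.

Lemma gdist_in x : A x -> gdist x <= 0.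
Proof. by move=> Ax; apply: gdist_le => v g _ /(_ _ Ax); rewrite subrr dotC dot0l. Qed.

Lemma gdistD x y c : (forall g, polar g -> dot g y <= c) -> gdist (x + y) <= gdist x + c.
Proof.
move=> hc; apply: gdist_le => v g pg h; rewrite -lerBlDr.
apply: (gdist_ub pg) => a Aa; rewrite lerBlDr (le_trans (h _ Aa))//.
by rewrite addrAC dotDr lerD2l hc.
Qed.

Lemma gdist_lip x y : gdist x <= gdist y + enorm (x - y).
Proof.
by rewrite -{1}(subrK y x) addrC; apply: gdistD => g pg; exact: polar_dot.
Qed.

Lemma gdist_step x s e : 0 <= e -> s \in S -> gdist (x + e *: s) <= gdist x + e.
Proof.
move=> e0 sS; apply: gdistD => g pg; rewrite dotZr -[leRHS]mulr1 ler_wpM2l//.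
exact: pg.
Qed.

Lemma gdist_parallel x e : 0 <= e -> parallel_body A e x -> gdist x <= e.
Proof.
move=> e0 [a [b [Aa [b1 ->]]]]; rewrite -[leRHS]add0r.
apply: (le_trans _ (lerD (gdist_in Aa) (lexx e))).
apply: gdistD => g pg; rewrite dotZr -[leRHS]mulr1 ler_wpM2l//.
by rewrite (le_trans (polar_dot _ pg)).
Qed.

(** Midpoint convexity: for each fixed [g] the gap is an affine function of the point, and [gdist]
    is a supremum of these. *)
Lemma gdist_midpoint x y z : z + z = x + y -> gdist z + gdist z <= gdist x + gdist y.
Proof.
move=> zxy.
suff : gdist z <= (gdist x + gdist y) / 2 by lra.
apply: gdist_le => v g pg h.
have hx : v + dot g (x - z) <= gdist x.
  apply: (gdist_ub pg) => a Aa; have := h _ Aa; rewrite !dotE; lra.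
have hy : v + dot g (y - z) <= gdist y.
  apply: (gdist_ub pg) => a Aa; have := h _ Aa; rewrite !dotE; lra.
have : dot g (z + z) = dot g (x + y) by rewrite zxy.
move: hx hy; rewrite !dotE; lra.
Qed.

(** A nearly optimal functional at [x], rescaled to equal 1 at some [t] of S, grows by [e] along
    [e *: t]. The supremum need not be attained, so [s] is fixed beforehand as the best of the
    finitely many moves. *)
Lemma gdist_move x e : 0 < gdist x ->
  exists2 s, s \in S & gdist x + e <= gdist (x + e *: s).
Proof.
move=> dx; have [s1 s1S _] := HS 0.
have [s sS hs] := seq_argmax (fun s => gdist (x + e *: s)) s1S.
exists s => //; rewrite leNgt; apply/negP => hlt.
(* The 0 makes [v] positive: then [g] is nonzero, and dividing by [dot g t <= 1] does not lower the
   gap. *)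
pose c := Num.max 0 (gdist (x + e *: s) - e).
have cx : c < gdist x by rewrite gt_max dx/=; lra.
have [v [g pg hv] cv] := sup_gt (gdist_has_sup x).1 cx.
have v0 : 0 < v by rewrite (le_lt_trans _ cv)// le_max lexx.
have g0 : g != 0.
  apply/negP => /eqP g0; have [a Aa] := A0.
  by have := hv _ Aa; rewrite g0 dot0l; lra.
have [t tS [m0 pt]] := scale_polar g0.
have m1 : dot g t <= 1 := pg _ tS.
have : v + e <= gdist (x + e *: t).
  apply: (gdist_ub pt) => a Aa; rewrite addrAC dotDr !dotZl (dotZr e).
  rewrite mulrCA mulVf ?mulr1 ?lt0r_neq0// lerD2r.
  by rewrite ler_pdivlMl// (le_trans _ (hv _ Aa))// ler_piMl// ltW.
have := hs _ tS; move: cv; rewrite gt_max; lra.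
Qed.

Hypothesis cA : compact A.
Hypothesis convA : convex_set_rV A.

(** The vector [g] from the nearest point of A to [x] separates the two with gap [dot g g]; rescaled
    into the polar it certifies a positive distance. *)
Lemma gdist_gt0 x : ~ A x -> 0 < gdist x.
Proof.
move=> nAx.
have [c /set_mem Ac hc] := @compact_EVT_min _ R (fun y : 'rV[R]_n => dot (x - y) (x - y)) A A0 cA
  (continuous_subspaceT (@dist2_continuous R n x)).
pose g := x - c.
have g0 : g != 0 by rewrite subr_eq0; apply: contra_notN nAx => /eqP ->.
have hg a : A a -> dot g (a - c) <= 0.
  move=> Aa; rewrite leNgt; apply/negP => q0.
  have [p Hp] : exists p, p = a - c by exists (a - c).
  rewrite -Hp in q0; set q := dot g p in q0; set w := dot p p.
  (* Minimality of [c] against points of the segment from [c] to [a]. The value [t = 1] shows that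
     [q / w] lies in [0, 1], and [t = q / w] then gives a contradiction. *)
  have key t : 0 <= t <= 1 -> 2 * t * q <= t ^+ 2 * w.
    move=> t01; have := hc (t *: a + (1 - t) *: c) (mem_set (convA Aa Ac t01)).
    have -> : x - (t *: a + (1 - t) *: c) = g - t *: p.
      by rewrite Hp; apply/rowP => i; rewrite !mxE; ring.
    have [g' Hg] : exists g', g' = g by exists g.
    rewrite /q /w -/g -Hg !dotE (dotC p g'); lra.
  have qw : 2 * q <= w by have := key 1; rewrite expr1n !mulr1 mul1r; apply; rewrite ler01 lexx.
  have w0 : 0 < w by lra.
  have qw1 : 0 <= q / w <= 1.
    by rewrite divr_ge0 ?(ltW q0) ?(ltW w0)// ler_pdivrMr// mul1r; lra.
  have := key _ qw1.
  have -> : (q / w) ^+ 2 * w = q * q / w by field; exact: lt0r_neq0.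
  have -> : 2 * (q / w) * q = 2 * (q * q / w) by field; exact: lt0r_neq0.
  have : 0 < q * q / w by rewrite divr_gt0// mulr_gt0.
  lra.
have [t tS [m0 pt]] := scale_polar g0.
have h : dot g g / dot g t <= gdist x.
  apply: (gdist_ub pt) => a Aa; rewrite dotZl mulrC ler_pM2l ?invr_gt0//.
  have -> : x - a = g - (a - c) by apply/rowP => i; rewrite !mxE; ring.
  by have := hg _ Aa; rewrite (dotDr g (- (a - c)) g) (dotNr (a - c)); lra.
by rewrite (lt_le_trans _ h)// divr_gt0// dot_gt0.
Qed.

End gauge_dist.

(** * The mass of an outer shell *)

Lemma measurable_set_ge0 d (T : measurableType d) (R : realType) (g : T -> R) :
  measurable_fun setT g -> measurable [set x | 0 <= g x].
Proof.
move=> mg; rewrite (_ : [set x | _] = g @^-1` `[0, +oo[%classic); last first.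
  by apply/seteqP; split => x /=; rewrite in_itv/= andbT.
by rewrite -[X in measurable X]setTI; apply: mg => //; exact: measurable_itv.
Qed.

Lemma measurable_set_gt0 d (T : measurableType d) (R : realType) (g : T -> R) :
  measurable_fun setT g -> measurable [set x | 0 < g x].
Proof.
move=> mg; rewrite (_ : [set x | _] = g @^-1` `]0, +oo[%classic); last first.
  by apply/seteqP; split => x /=; rewrite in_itv/= andbT.
by rewrite -[X in measurable X]setTI; apply: mg => //; exact: measurable_itv.
Qed.

Section lam_translation.
Context {R : realType} {n : nat}.

Lemma measurable_translate (b : 'rV[R]_n) (g : rVb R n -> R) :
  measurable_fun setT g ->
  measurable_fun [set: rVb R n] (fun x : rVb R n => g ((x : 'rV[R]_n) + b)).
Proof.
move=> mg; rewrite (_ : (fun _ => _) = g \o (fun x : rVb R n => 1 *: (x : 'rV[R]_n) + b)).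
  exact: (measurableT_comp mg (affine_measurable 1 b)).
by apply/funext => x /=; rewrite scale1r.
Qed.

Lemma integral_lam_translate (b : 'rV[R]_n) (g : rVb R n -> R) :
  measurable_fun setT g -> (forall x, 0 <= g x) ->
  (\int[lam n]_x (g ((x : 'rV[R]_n) + b)%R)%:E = \int[lam n]_x (g x)%:E)%E.
Proof.
move=> mg g0.
have := @ge0_integral_lam_affine R n 1 b (EFin \o g) ltr01.
rewrite invr1 expr1n mul1e => <- //; last exact/measurable_EFinP.
by apply: eq_integral => x _; rewrite scale1r.
Qed.

End lam_translation.

Section outer_mass.
Context {R : realType} {n : nat} (S : seq 'rV[R]_n) (A : set 'rV[R]_n) (e : R).
Context (f h : rVb R n -> R).
Hypothesis HS : forall g, exists2 s, s \in S & enorm g <= dot g s.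
Hypothesis A0 : A !=set0.
Hypothesis cA : compact A.
Hypothesis convA : convex_set_rV A.
Hypothesis e0 : 0 < e.
Hypothesis mf : measurable_fun setT f.
Hypothesis f0 : forall x, 0 <= f x.
Hypothesis h0 : forall x, 0 <= h x.
Hypothesis hf : forall x, h x <= f x.
Hypothesis hfS : forall x s, s \in S -> h x <= f ((x : 'rV[R]_n) + e *: s).

Let d : rVb R n -> R := gdist S A.

Let md : measurable_fun setT d.
Proof. by apply: continuous_measurable_rV; apply: lip_continuous; exact: gdist_lip. Qed.

Let s_ i := nth 0 S i.

Let V i : set (rVb R n) :=
  [set x | 0 < d x /\ d x + e <= d ((x : 'rV[R]_n) + e *: s_ i)].

Let mV i : measurable (V i).
Proof.
rewrite (_ : V i = [set x | 0 < d x] `&`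
    [set x : rVb R n | 0 <= d ((x : 'rV[R]_n) + e *: s_ i) - (d x + e)]); last first.
  by apply/seteqP; split => x /=; rewrite subr_ge0.
apply: measurableI; first exact: measurable_set_gt0.
apply: measurable_set_ge0; apply: measurable_funB; first exact: measurable_translate.
exact: measurable_funD.
Qed.

(** Each point outside A is assigned the first index of S along which [d] grows at full speed. *)
Let E := seqDU V.

Let mE i : measurable (E i).
Proof. by apply: measurableD => //; apply: bigsetU_measurable => j _; exact: mV. Qed.

Let V_shift i x : (i < size S)%N -> V i x -> d ((x : 'rV[R]_n) + e *: s_ i) = d x + e.
Proof.
move=> iS [_ h1]; apply/eqP; rewrite eq_le h1 andbT.
by apply: gdist_step => //; [exact: ltW|exact: mem_nth].
Qed.

(* By convexity, a direction that is optimal at [x'] is optimal at [x] as soon as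
   both points are moved to the same place: this makes the outward move injective. *)
Let V_swap i j (x x' : 'rV[R]_n) : (i < size S)%N -> (j < size S)%N ->
  V i x -> V j x' -> x + e *: s_ i = x' + e *: s_ j -> V j x.
Proof.
move=> iS jS Vi Vj xx'; split; first by case: Vi.
have dxx' : d x = d x'.
  by apply: (@addIr _ e); rewrite -(V_shift iS Vi) -(V_shift jS Vj) xx'.
pose z := x + (e / 2) *: s_ i.
have hz : d x + e / 2 <= d z.
  have : d (x + e *: s_ i) <= d z + e / 2.
    rewrite (_ : x + e *: s_ i = z + (e / 2) *: s_ i).
      by apply: gdist_step => //; [rewrite divr_ge0// ltW|exact: mem_nth].
    by rewrite /z -addrA -scalerDl; congr (_ + _ *: _); lra.
  by rewrite (V_shift iS Vi); lra.
(* [z], the midpoint of [x] and [x + e *: s_ i], is also the midpoint of [x + e *: s_ j] and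
   [x']. *)
have : d z + d z <= d (x + e *: s_ j) + d x'.
  apply: gdist_midpoint => //.
  have -> : x + e *: s_ j + x' = x + (x' + e *: s_ j).
    by rewrite -addrA (addrC (e *: _)).
  by rewrite -xx' /z; apply/rowP => k; rewrite !mxE; field.
rewrite -dxx'; lra.
Qed.

(** The density [f] restricted to the image of [E i] under translation by [e *: s_ i]. *)
Let G i : rVb R n -> R := fun z =>
  \1_(E i) ((z : 'rV[R]_n) - e *: s_ i : rVb R n) * f z.

Let mG i : measurable_fun setT (G i).
Proof.
apply: measurable_funM => //.
apply: (@measurable_translate R n (- (e *: s_ i)) (\1_(E i))).
exact: measurable_indic.
Qed.

Let G0 i x : 0 <= G i x.
Proof. by rewrite mulr_ge0. Qed.

Let h_le x : h x <= \1_[set x | 0 <= - d x] x * f x +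
  \sum_(i < size S) G i ((x : 'rV[R]_n) + e *: s_ i).
Proof.
have [dx|dx] := leP (d x) 0.
  rewrite indicE mem_set/= ?oppr_ge0// mul1r -[leLHS]addr0 lerD//.
  by apply: sumr_ge0.
rewrite -[leLHS]add0r lerD//; first by rewrite mulr_ge0.
have [s sS hs] := gdist_move HS A0 e dx.
(* The least such index is the one with [x] in [E i]; it is at most the index of [s], hence below
   [size S]. *)
have exV : exists i, `[< V i x >].
  by exists (index s S); apply/asboolP; split => //; rewrite /s_ nth_index.
case: (ex_minnP exV) => i /asboolP Vix imin.
have iS : (i < size S)%N.
  rewrite (leq_ltn_trans (imin (index s S) _)) ?index_mem//.
  by apply/asboolP; split => //; rewrite /s_ nth_index.
rewrite (bigD1 (Ordinal iS))//= -[leLHS]addr0 lerD//; last by apply: sumr_ge0.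
rewrite /G addrK indicE mem_set ?mul1r; first by apply: hfS; exact: mem_nth.
split => //; rewrite -bigcup_mkord => -[j /= ji Vjx].
by have := imin j; rewrite leqNgt ji; move/(_ (asboolT Vjx)).
Qed.

(** The translated pieces are disjoint: if two of them met at [z], [V_swap] would make the smaller
    index admissible for the point assigned the larger one. They lie in {d > e}, because a move adds
    exactly [e] to a positive distance. *)
Let sumG_le z : \sum_(i < size S) G i z <= \1_[set x | 0 < d x - e] z * f z.
Proof.
have [[i Ei]|nE] := pselect (exists i : 'I_(size S), E i ((z : 'rV[R]_n) - e *: s_ i)); last first.
  rewrite big1 ?mulr_ge0// => i _; rewrite /G indicE memNset ?mul0r// => Ei.
  by apply: nE; exists i.
have dz : [set x | 0 < d x - e] z.
  have Vi : V i ((z : 'rV[R]_n) - e *: s_ i) := Ei.1.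
  have /= := V_shift (ltn_ord i) Vi; rewrite subrK => ->.
  by rewrite addrK; case: Vi.
rewrite (bigD1 i)//= big1 ?addr0; first by rewrite ler_wpM2r// !indicE (mem_set dz) lern1 leq_b1.
move=> j ji; rewrite /G indicE memNset ?mul0r// => Ej.
have eqz : (z : 'rV[R]_n) - e *: s_ i + e *: s_ i = z - e *: s_ j + e *: s_ j by rewrite !subrK.
have [ij|ij] := ltnP i j.
  apply: Ej.2; rewrite -bigcup_mkord; exists i => //=.
  exact: (V_swap (ltn_ord j) (ltn_ord i) Ej.1 Ei.1 (esym eqz)).
apply: Ei.2; rewrite -bigcup_mkord; exists j => //=.
  by rewrite ltn_neqAle ij andbT.
exact: (V_swap (ltn_ord i) (ltn_ord j) Ei.1 Ej.1 eqz).
Qed.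

(** The sets {d <= 0}, {0 < d <= e} and {d > e} are disjoint. The shell lies in the second, and the
    integral of [h] is at most the mass of [f] on the other two. *)
Lemma outer_mass_le :
  (dmeasure f (parallel_body A e `\` A) + \int[lam n]_x (h x)%:E <=
   \int[lam n]_x (f x)%:E)%E.
Proof.
have m1 : measurable [set x | 0 <= - d x].
  by apply: measurable_set_ge0; exact: measurable_funN.
have m2 : measurable [set x | 0 < d x - e].
  by apply: measurable_set_gt0; exact: measurable_funB.
have m3 : measurable ([set x | 0 < d x] `&` [set x | 0 <= e - d x]).
  apply: measurableI; first exact: measurable_set_gt0.
  by apply: measurable_set_ge0; exact: measurable_funB.
have mfi B : measurable B -> measurable_fun [set: rVb R n] (fun x => \1_B x * f x).
  by move=> mB; apply: measurable_funM => //; exact: measurable_indic.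
have mGi (i : 'I_(size S)) : measurable_fun [set: rVb R n]
    (fun x : rVb R n => G i ((x : 'rV[R]_n) + e *: s_ i)).
  exact: (measurable_translate (e *: s_ i) (mG i)).
have H1 : (dmeasure f (parallel_body A e `\` A) <=
    \int[lam n]_x (\1_([set x | 0 < d x] `&` [set x | 0 <= e - d x]) x * f x)%:E)%E.
  rewrite -iintE; last 2 first.
  - by apply/measurable_EFinP; exact: mfi.
  - by move=> x; rewrite lee_fin mulr_ge0.
  apply: le_iint => x; rewrite lee_fin ?mulr_ge0// ler_wpM2r// !indicE.
  have [xA|] := boolP (x \in _ `\` _); last by [].
  rewrite mem_set//; move/set_mem : xA => [px nAx]; split => /=.
    exact: (gdist_gt0 HS A0 cA convA nAx).
  by rewrite subr_ge0; apply: (gdist_parallel HS A0 (ltW e0)).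
have H2 : (\int[lam n]_x (h x)%:E <=
    \int[lam n]_x (\1_[set x | 0 <= - d x] x * f x)%:E +
    \int[lam n]_x (\1_[set x | 0 < d x - e] x * f x)%:E)%E.
  have mS : measurable_fun [set: rVb R n] (fun x : rVb R n =>
      \sum_(i < size S) G i ((x : 'rV[R]_n) + e *: s_ i)).
    by apply: measurable_sum => i; exact: mGi.
  apply: (@le_trans _ _ (\int[lam n]_x ((\1_[set x | 0 <= - d x] x * f x)%:E +
     (\sum_(i < size S) G i ((x : 'rV[R]_n) + e *: s_ i)%R)%:E))%E).
    by apply: ge0_le_integralT => x; rewrite ?lee_fin//; exact: h_le.
  rewrite ge0_integralD//; last 4 first.
  - by move=> x _; rewrite lee_fin mulr_ge0.
  - by apply/measurable_EFinP; exact: mfi.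
  - by move=> x _; rewrite lee_fin sumr_ge0.
  - exact/measurable_EFinP.
  apply: leeD => //.
  (* Translation invariance, applied to each summand with its own vector. *)
  have -> : (\int[lam n]_x (\sum_(i < size S) G i ((x : 'rV[R]_n) + e *: s_ i)%R)%:E =
             \int[lam n]_x (\sum_(i < size S) G i x)%:E)%E.
    under eq_integral do rewrite -sumEFin.
    under [RHS]eq_integral do rewrite -sumEFin.
    rewrite !ge0_integral_sum//; last 4 first.
    - by move=> i; apply/measurable_EFinP; exact: mG.
    - by move=> i x _; rewrite lee_fin.
    - by move=> i; apply/measurable_EFinP; exact: mGi.
    - by move=> i x _; rewrite lee_fin.
    by apply: eq_bigr => i _; rewrite (integral_lam_translate (e *: s_ i) (mG i)).
  apply: ge0_le_integralT => x; first by rewrite lee_fin sumr_ge0.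
  by rewrite lee_fin sumG_le.
apply: (le_trans (leeD H1 H2)).
have p0 B x : (0 <= (\1_B x * f x)%:E)%E by rewrite lee_fin mulr_ge0.
have mp B : measurable B -> measurable_fun [set: rVb R n] (fun x => (\1_B x * f x)%:E).
  by move=> mB; apply/measurable_EFinP; exact: mfi.
rewrite -[X in (_ + X)%E](ge0_integralD (lam n) measurableT (fun x _ => p0 _ x) (mp _ m1)
  (fun x _ => p0 _ x) (mp _ m2)).
rewrite -[leLHS](ge0_integralD (lam n) measurableT (fun x _ => p0 _ x) (mp _ m3)
  (fun x _ => adde_ge0 (p0 _ x) (p0 _ x)) (emeasurable_funD (mp _ m1) (mp _ m2))).
apply: ge0_le_integralT => x; rewrite -!EFinD lee_fin.
  by rewrite !addr_ge0// mulr_ge0.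
rewrite -!mulrDl ler_piMl// !indicE !in_setI.
have -> : (x \in [set x | 0 < d x]) = (0 < d x) by apply/idP/idP => [/set_mem//|/mem_set].
have -> : (x \in [set x | 0 <= e - d x]) = (0 <= e - d x) by apply/idP/idP => [/set_mem//|/mem_set].
have -> : (x \in [set x | 0 <= - d x]) = (0 <= - d x) by apply/idP/idP => [/set_mem//|/mem_set].
have -> : (x \in [set x | 0 < d x - e]) = (0 < d x - e) by apply/idP/idP => [/set_mem//|/mem_set].
rewrite oppr_ge0 !subr_ge0 subr_gt0.
have := e0; case: (ltP 0 (d x)) => hx; case: (ltP e (d x)) => hx2 /=; lra.
Qed.

End outer_mass.

(** * Integrals with prescribed values *)

Section has_int.
Context {d} {T : measurableType d} {R : realType} (mu : {measure set T -> \bar R}).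

(** Integrability is bundled with a real value so that moment estimates become real arithmetic. *)
Definition has_int (g : T -> R) (v : R) :=
  mu.-integrable setT (EFin \o g) /\ (\int[mu]_x (g x)%:E = v%:E)%E.

Lemma has_int_measurable g v : has_int g v -> measurable_fun setT g.
Proof. by case=> /integrableP[/measurable_EFinP]. Qed.

Lemma has_intD g h v w : has_int g v -> has_int h w -> has_int (fun x => g x + h x) (v + w).
Proof.
move=> [ig eg] [ih eh]; split.
  rewrite (_ : _ \o _ = (EFin \o g) \+ (EFin \o h)); first exact: integrableD.
  by apply/funext => x /=; rewrite EFinD.
under eq_integral do rewrite EFinD.
by rewrite integralD//= eg eh.
Qed.

Lemma has_intZ c g v : has_int g v -> has_int (fun x => c * g x) (c * v).
Proof.
move=> [ig eg]; split.
  rewrite (_ : _ \o _ = (fun x => c%:E * (EFin \o g) x)%E); first exact: integrableZl.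
  by apply/funext => x /=; rewrite EFinM.
under eq_integral do rewrite EFinM.
by rewrite integralZl//= eg EFinM.
Qed.

Lemma has_int0 : has_int (fun=> 0) 0.
Proof. by split; [exact: integrable0|rewrite integral0]. Qed.

Lemma has_int_sum (I : Type) (r : seq I) (g : I -> T -> R) (v : I -> R) :
  (forall i, has_int (g i) (v i)) ->
  has_int (fun x => \sum_(i <- r) g i x) (\sum_(i <- r) v i).
Proof.
move=> H; elim: r => [|i r IH].
  rewrite big_nil (_ : (fun x => _) = fun=> 0); first exact: has_int0.
  by apply/funext => x; rewrite big_nil.
rewrite big_cons (_ : (fun x => _) = (fun x => g i x + \sum_(j <- r) g j x)).
  exact: has_intD.
by apply/funext => x; rewrite big_cons.
Qed.

Lemma has_int_le g h v w : has_int g v -> has_int h w -> (forall x, g x <= h x) -> v <= w.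
Proof.
move=> [ig eg] [ih eh] gh; rewrite -lee_fin -eg -eh.
by apply: le_integral => // x _; rewrite lee_fin.
Qed.

Lemma has_int_ge0 g v : has_int g v -> (forall x, 0 <= g x) -> 0 <= v.
Proof. by move=> ig g0; apply: (has_int_le has_int0 ig). Qed.

Lemma has_int_dom (g h : T -> R) w : measurable_fun setT g -> has_int h w ->
  (forall x, 0 <= g x <= h x) -> exists2 v, has_int g v & v <= w.
Proof.
move=> mg ih gh; have ig : mu.-integrable setT (EFin \o g).
  apply: (le_integrable measurableT _ _ ih.1) => //; first exact/measurable_EFinP.
  move=> x _ /=; have /andP[g0 gx] := gh x.
  by rewrite lee_fin !ger0_norm// (le_trans g0).
have hg : has_int g (fine (\int[mu]_x (g x)%:E)%E).
  by split => //; rewrite fineK//; exact: integrable_fin_num.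
exists (fine (\int[mu]_x (g x)%:E)%E) => //.
by apply: (has_int_le hg ih) => x; case/andP: (gh x).
Qed.

Lemma has_int_ext g h v : g =1 h -> has_int g v -> has_int h v.
Proof. by move=> /funext ->. Qed.

End has_int.

Lemma has_int_affine (R : realType) n (a : R) (b : 'rV[R]_n) (g : rVb R n -> R) v : 0 < a ->
  (forall x, 0 <= g x) -> has_int (lam n) g v ->
  has_int (lam n) (fun x : rVb R n => g (a *: (x : 'rV[R]_n) + b)) (a^-1 ^+ n * v).
Proof.
move=> a0 g0 ig; have mg := has_int_measurable ig.
have eg : (\int[lam n]_x (g (a *: (x : 'rV[R]_n) + b)%R)%:E = (a^-1 ^+ n * v)%:E)%E.
  by rewrite EFinM -ig.2 -(@ge0_integral_lam_affine R n a b (EFin \o g))//; exact/measurable_EFinP.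
split => //; apply/integrableP; split.
  apply/measurable_EFinP; exact: (measurableT_comp mg (affine_measurable a b)).
under eq_integral do rewrite /= ger0_norm//.
by rewrite eg ltry.
Qed.

Section sint_integral.
Context {R : realType} {n : nat}.

Lemma sint_has_int (g : 'rV[R]_n -> R) (v : R) : measurable_fun [set: rVb R n] g ->
  sint g = v%:E -> has_int (lam n) g v.
Proof.
move=> mg; rewrite /sint.
have mgE : measurable_fun [set: rVb R n] (EFin \o g) by exact/measurable_EFinP.
have Ep : (fun x => (Num.max (g x) 0)%:E) = ((EFin \o g)^\+)%E.
  by apply/funext => x; rewrite funeposE /= EFin_max.
have En : (fun x => (Num.max (- g x) 0)%:E) = ((EFin \o g)^\-)%E.
  by apply/funext => x; rewrite funenegE /= EFin_max.
rewrite Ep En !iintE; last 4 first.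
- exact: measurable_funeneg.
- by move=> x; exact: funeneg_ge0.
- exact: measurable_funepos.
- by move=> x; exact: funepos_ge0.
set p := (\int[_]_x _)%E; set q := (\int[_]_x _)%E => pq.
have p0 : (0 <= p)%E by apply: integral_ge0 => x _; exact: funepos_ge0.
have q0 : (0 <= q)%E by apply: integral_ge0 => x _; exact: funeneg_ge0.
(* By convention [+oo - +oo] is [-oo], so a finite difference forces both parts to be finite. *)
have [pf qf] : (p < +oo)%E /\ (q < +oo)%E.
  by move: p0 q0 pq; case: p => [p||]; case: q => [q||] //=; rewrite !ltry.
split; last by rewrite integralE.
apply/integrableP; split => //.
rewrite (eq_integral (fun x : rVb R n => ((EFin \o g)^\+ x + (EFin \o g)^\- x)%E)); last first.
  by move=> x _; rewrite -[RHS]/(((EFin \o g)^\+ \+ (EFin \o g)^\-)%E x) -fune_abse.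
rewrite ge0_integralD//; first by rewrite lte_add_pinfty.
- exact: measurable_funepos.
- exact: measurable_funeneg.
Qed.

End sint_integral.

(** * Log-concave densities *)

Lemma bernoulli_ineq (R : realDomainType) (d : R) j :
  0 <= d <= 1 -> 1 - j%:R * d <= (1 - d) ^+ j.
Proof.
move=> /andP[d0 d1]; elim: j => [|j IH]; first by rewrite mul0r subr0 expr0.
rewrite exprS; have : (1 - d) * (1 - j%:R * d) <= (1 - d) * (1 - d) ^+ j.
  by rewrite ler_wpM2l// subr_ge0.
have : 0 <= j%:R * d * d by rewrite !mulr_ge0.
rewrite -[j.+1%:R]natr1; lra.
Qed.

Section logconcave.
Context {R : realType} {n : nat} (f : rVb R n -> R).
Hypothesis f0 : forall x, 0 <= f x.
Hypothesis If : has_int (lam n) f 1.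
Hypothesis lc : forall (x y : 'rV[R]_n) t, 0 <= t <= 1 ->
  f x `^ t * f y `^ (1 - t) <= f (t *: x + (1 - t) *: y).

Let mf : measurable_fun setT f := has_int_measurable If.

Lemma logconcave_midpoint (x y : 'rV[R]_n) :
  Num.sqrt (f x) * Num.sqrt (f y) <= f (2^-1 *: x + 2^-1 *: y).
Proof.
have h : 1 - 2^-1 = 2^-1 :> R by lra.
have := @lc x y 2^-1; rewrite h !powR12_sqrt//; apply; lra.
Qed.

(** Integrating the midpoint inequality in one variable gives [Num.sqrt (f y) * J <= 2 ^+ n], and
    [J] is positive since [f] has mass 1. *)
Lemma logconcave_bounded : exists B, forall x, f x <= B.
Proof.
pose J := (\int[lam n]_x (Num.sqrt (f x))%:E)%E.
have ms : measurable_fun [set: rVb R n] (fun x => Num.sqrt (f x)).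
  apply: (measurableT_comp _ mf); apply: continuous_measurable_fun.
  exact: sqrt_continuous.
have J0 : (0 < J)%E.
  rewrite lt0e integral_ge0 ?andbT; last by move=> x _; rewrite lee_fin sqrtr_ge0.
  apply/eqP => J0; have : (\int[lam n]_x (f x)%:E = \int[lam n]_x 0)%E.
    apply: ge0_ae_eq_integral => //.
    - exact/measurable_EFinP.
    - by move=> x _; rewrite lee_fin.
    have /ae_eq_integral_abs : measurable_fun [set: rVb R n] (fun x => (Num.sqrt (f x))%:E).
      exact/measurable_EFinP.
    move=> /(_ (lam n) measurableT)[+ _].
    rewrite (eq_integral (fun x => (Num.sqrt (f x))%:E)); last first.
      by move=> x _; rewrite gee0_abs// lee_fin sqrtr_ge0.
    move=> /(_ J0); apply: filterS => x /(_ I)/= [/eqP].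
    by rewrite sqrtr_eq0 => fx0 _; congr EFin; apply/eqP; rewrite eq_le fx0 f0.
  by rewrite integral0 If.2 => /eqP; rewrite eqe oner_eq0.
have key y : ((Num.sqrt (f y))%:E * J <= (2 ^+ n)%:E)%E.
  rewrite -ge0_integralZl_EFin//; last exact/measurable_EFinP.
  have h2 : (0 : R) < 2^-1 by rewrite invr_gt0.
  have [_ +] := has_int_affine (2^-1 *: (y : 'rV[R]_n)) h2 f0 If.
  rewrite invrK mulr1 => <-.
  apply: ge0_le_integralT => x; first by rewrite -EFinM lee_fin mulr_ge0 ?sqrtr_ge0.
  by rewrite -EFinM lee_fin mulrC; exact: logconcave_midpoint.
(* [J] may be infinite; any positive real below it serves. *)
have [j j0 jJ] : exists2 j : R, 0 < j & (j%:E <= J)%E.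
  move: J0; case: (J) => [j|_|//]; first by rewrite lte_fin => j0; exists j.
  by exists 1 => //; rewrite leey.
exists ((2 ^+ n / j) ^+ 2) => y.
rewrite -[leLHS](sqr_sqrtr (f0 y)) ler_pXn2r ?nnegrE ?sqrtr_ge0//; last first.
  by rewrite divr_ge0 ?exprn_ge0 ?ltW.
rewrite ler_pdivlMr// -lee_fin EFinM (le_trans _ (key y))//.
by rewrite lee_wpmul2l// lee_fin sqrtr_ge0.
Qed.

(** As [f q] is at least [f x / 2 ^+ m], log-concavity loses at most the factor 2^(-m d), which is
    at least 1 - m d by [expR_ge1Dx] and [ln 2 <= 1]. *)
Lemma logconcave_contract M (m : nat) (x q : 'rV[R]_n) d :
  0 < M -> f x <= M -> M / 2 ^+ m <= f q -> 0 <= d <= 1 ->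
  f x * (1 - m%:R * d) <= f ((1 - d) *: x + d *: q).
Proof.
move=> M0 fM fq /andP[d0 d1].
have d01 : 0 <= 1 - d <= 1 by apply/andP; split; lra.
have dd : 1 - (1 - d) = d by ring.
have := @lc x q (1 - d) d01; rewrite dd.
apply: le_trans.
have [fx|fx] := eqVneq (f x) 0.
  by rewrite fx mul0r mulr_ge0// powR_ge0.
have p2 : (0 : R) < 2 ^+ m by rewrite exprn_gt0.
have fqx : f x * (2 ^+ m)^-1 <= f q.
  by rewrite (le_trans _ fq)// ler_wpM2r// invr_ge0 ltW.
apply: (@le_trans _ _ (f x `^ (1 - d) * (f x * (2 ^+ m)^-1) `^ d)); last first.
  rewrite ler_wpM2l ?powR_ge0//; apply: ge0_ler_powR => //.
    by rewrite nnegrE mulr_ge0// invr_ge0 ltW.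
  by rewrite nnegrE f0.
rewrite powRM ?invr_ge0 ?(ltW p2)// mulrA -powRD; last by rewrite fx implybT.
rewrite subrK powRr1// ler_wpM2l//.
rewrite /powR invr_eq0 (negbTE (lt0r_neq0 p2)).
rewrite (le_trans _ (expR_ge1Dx _))// lerD2l lnV ?posrE// lnXn//.
have l2 : ln (2 : R) <= 1 by have := @le_ln1Dx R 1; rewrite (_ : 1 + 1 = 2)//; apply; lra.
rewrite mulrN lerN2 (mulrC m%:R) ler_wpM2l//.
exact: (ler_wMn2r m l2).
Qed.

End logconcave.

(** * The width of a high level set *)

Section width.
Context {R : realType} {n : nat} (f : rVb R n -> R).
Hypothesis n0 : (0 < n)%N.
Hypothesis f0 : forall x, 0 <= f x.
Hypothesis If : has_int (lam n) f 1.
Hypothesis lc : forall (x y : 'rV[R]_n) t, 0 <= t <= 1 ->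
  f x `^ t * f y `^ (1 - t) <= f (t *: x + (1 - t) *: y).
Context (M : R) (x0 u : 'rV[R]_n) (r : R).
Hypothesis M0 : 0 < M.
Hypothesis fM : forall x, f x <= M.
Hypothesis fx0 : M < 2 * f x0.
Hypothesis r0 : 0 < r.
Hypothesis r2 : 128 * 164 * n%:R * r ^+ 2 = 1.
Hypothesis Iu : has_int (lam n) (fun x : rVb R n => dot u x * f x) 0.
Hypothesis Iu2 : has_int (lam n) (fun x : rVb R n => dot u x ^+ 2 * f x) 1.
Hypothesis uK : forall q : 'rV[R]_n, M / 2 ^+ (82 * n) <= f q -> dot u q <= r.

Let m := (82 * n)%N.
Let mf : measurable_fun setT f := has_int_measurable If.
Let N : R := n%:R.
(** The mass off K will be at most [2 / D ^+ 2]. The exponent 82 of the level is 2 (2 * 20 + 1): a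
    square root halves it, and the change of variables costs one factor [2 ^+ n]. *)
Let D : R := 2 ^+ (20 * n).
(** The slack in the assumed width bound, nonnegative on K. *)
Let W (x : rVb R n) : R := r - dot u x.
(** The indicator of the complement of K. *)
Let k (x : rVb R n) : R := \1_[set x | 0 < M / 2 ^+ m - f x] x.
Let Wp (x : rVb R n) : R := Num.max (W x) 0.

Let N1 : 1 <= N. Proof. by rewrite /N ler1n. Qed.

Let D_ge : 1024 * 1024 * N <= D.
Proof.
rewrite /D exprM; have -> : (2 : R) ^+ 20 = 1024 * 1024 by ring.
have hB (B : R) j : 2 <= B -> B * j.+1%:R <= B ^+ j.+1.
  move=> B2; rewrite exprS ler_wpM2l ?(le_trans _ B2)//.
  elim: j => [|j IH]; first by rewrite expr0.
  rewrite exprS -natr1.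
  have h1 : 1 <= B ^+ j by rewrite exprn_ege1//; lra.
  have : 0 <= (B - 2) * B ^+ j by rewrite mulr_ge0//; lra.
  lra.
have B2 : (2 : R) <= 1024 * 1024 by lra.
by have := hB _ n.-1 B2; rewrite prednK.
Qed.

Let mW : measurable_fun setT W.
Proof.
apply: measurable_funB => //; apply: measurable_sum => i.
by apply: measurable_funM => //; exact: coord_measurable.
Qed.

Let mk : measurable_fun setT k.
Proof.
apply: measurable_indic; apply: measurable_set_gt0.
exact: measurable_funB.
Qed.

Let mWp : measurable_fun setT Wp.
Proof. exact: measurable_maxr. Qed.

Let k01 x : 0 <= k x <= 1.
Proof. by rewrite /k indicE; case: (_ \in _); rewrite /= ?lexx ler01. Qed.

Let k_out x : f x < M / 2 ^+ m -> k x = 1.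
Proof. by move=> h; rewrite /k indicE mem_set//= subr_gt0. Qed.

Let k_in x : M / 2 ^+ m <= f x -> k x = 0.
Proof. by move=> h; rewrite /k indicE memNset//= subr_gt0 ltNge h. Qed.

Let W_in x : M / 2 ^+ m <= f x -> 0 <= W x.
Proof. by move=> h; rewrite subr_ge0 uK. Qed.

Let IW1 : has_int (lam n) (fun x => W x * f x) r.
Proof.
have := has_intD (has_intZ r If) (has_intZ (-1) Iu).
rewrite mulr1 mulr0 addr0; apply: has_int_ext => x; rewrite /W; ring.
Qed.

Let IW2 : has_int (lam n) (fun x => W x ^+ 2 * f x) (r ^+ 2 + 1).
Proof.
have := has_intD (has_intD (has_intZ (r ^+ 2) If) (has_intZ (- (2 * r)) Iu)) Iu2.
rewrite mulr1 mulr0 addr0; apply: has_int_ext => x; rewrite /W; ring.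
Qed.

Let two_pos j : (0 : R) < 2 ^+ j. Proof. exact: exprn_gt0. Qed.

Let c : R := 2 / 2 ^+ (41 * n).

Let c_eq : c * 2 ^+ n = 2 / D ^+ 2.
Proof.
rewrite /c /D -exprM (_ : 41 * n = 20 * n * 2 + n)%N; last by lia.
rewrite exprD; field; rewrite !lt0r_neq0//.
Qed.

(* Off K, [f x] is at most [c] times the geometric mean of [f x] and [f x0], hence
   at most [c] times the value of [f] at the midpoint of [x] and [x0]. *)
Let out_le (x : 'rV[R]_n) : k x * f x <= c * f (2^-1 *: x + 2^-1 *: x0).
Proof.
have c0 : 0 < c by rewrite divr_gt0.
have [h|h] := leP (M / 2 ^+ m) (f x); first by rewrite k_in// mul0r mulr_ge0// ltW.
rewrite k_out// mul1r.
have s1 : f x <= c ^+ 2 * f x0.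
  rewrite (le_trans (ltW h))//.
  have -> : c ^+ 2 = 4 / 2 ^+ m.
    rewrite /c exprMn -exprVn -exprM exprVn (_ : 41 * n * 2 = m)%N; last by rewrite /m; lia.
    by congr (_ / _); ring.
  rewrite mulrAC ler_wpM2r ?invr_ge0 ?(ltW (two_pos _))//.
  by have := f0 x0; move: fx0; lra.
have s2 : Num.sqrt (f x) <= c * Num.sqrt (f x0).
  rewrite -[X in X * _](ger0_norm (ltW c0)) -sqrtr_sqr -sqrtrM ?sqr_ge0//.
  by rewrite ler_sqrt// mulr_ge0// sqr_ge0.
rewrite -[leLHS](sqr_sqrtr (f0 x)) expr2.
apply: (@le_trans _ _ (Num.sqrt (f x) * (c * Num.sqrt (f x0)))).
  by rewrite ler_wpM2l ?sqrtr_ge0.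
by rewrite mulrCA ler_wpM2l ?(ltW c0)// logconcave_midpoint.
Qed.

Let Ik : exists2 a, has_int (lam n) (fun x => k x * f x) a & a <= 2 / D ^+ 2.
Proof.
have h2 : (0 : R) < 2^-1 by rewrite invr_gt0.
have := has_intZ c (has_int_affine (2^-1 *: x0) h2 f0 If).
rewrite invrK mulr1 c_eq => H; apply: (has_int_dom _ H); first exact: measurable_funM.
by move=> x; rewrite out_le andbT mulr_ge0//; case/andP: (k01 x).
Qed.

(** [out_le] again, with [W] affine: [W x = 2 * W z - W x0] at the midpoint [z], which bounds
    [W x ^+ 2] by second moments at [z]. *)
Let IkW : exists2 b, has_int (lam n) (fun x => k x * W x ^+ 2 * f x) b &
  b <= 2 / D ^+ 2 * (8 * (r ^+ 2 + 1) + 2 * W x0 ^+ 2).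
Proof.
have h2 : (0 : R) < 2^-1 by rewrite invr_gt0.
pose Q (z : rVb R n) := 8 * (W z ^+ 2 * f z) + 2 * W x0 ^+ 2 * f z.
have IQ := has_intD (has_intZ 8 IW2) (has_intZ (2 * W x0 ^+ 2) If).
have Q0 z : 0 <= Q z 
  by apply: addr_ge0; apply: mulr_ge0 => //; apply: mulr_ge0 => //; exact: sqr_ge0.
have := has_intZ c (has_int_affine (2^-1 *: x0) h2 Q0 IQ).
rewrite invrK mulr1 mulrA c_eq => H; apply: (has_int_dom _ H).
  apply: measurable_funM => //; apply: measurable_funM => //; exact: measurable_funX.
move=> x; apply/andP; split.
  by rewrite mulr_ge0// mulr_ge0 ?sqr_ge0//; case/andP: (k01 x).
rewrite mulrAC (le_trans (ler_wpM2r (sqr_ge0 _) (out_le x)))//.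
have c0 : 0 < c by rewrite divr_gt0.
rewrite -mulrA ler_wpM2l ?(ltW c0)// /Q.
set z := 2^-1 *: (x : 'rV[R]_n) + 2^-1 *: x0.
have Wz : W x = 2 * W z - W x0.
  rewrite /W /z !dotE; lra.
have : W x ^+ 2 <= 8 * W z ^+ 2 + 2 * W x0 ^+ 2.
  rewrite Wz; have := sqr_ge0 (2 * W z + W x0); lra.
have := f0 z; nra.
Qed.

(** [Wp] exceeds [W] only off K. The weight [2 / D] in AM-GM balances the tiny mass there against
    the bounded second moment. *)
Let IWp : exists2 P, has_int (lam n) (fun x => Wp x * f x) P & P <= r + 4 / D.
Proof.
have [a Ia ha] := Ik.
have D0 : 0 < D := two_pos _.
have xi0 : 0 < 2 / D by rewrite divr_gt0.
have IB := has_intD IW1 (has_intD (has_intZ (2^-1 / (2 / D)) Ia) (has_intZ (2^-1 * (2 / D)) IW2)).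
have [|x|P IP hP] := has_int_dom _ IB (g := fun x => Wp x * f x).
- exact: measurable_funM.
- rewrite mulr_ge0//=; last by rewrite le_max lexx orbT.
  rewrite (_ : _ + _ = (W x + (2^-1 / (2 / D) * k x + 2^-1 * (2 / D) * W x ^+ 2)) * f x).
    2: by rewrite !mulrDl !mulrA.
  rewrite ler_wpM2r//.
  have := k01 x; rewrite /Wp; have [W0|W0] := leP 0 (W x).
    move=> /andP[k0 _].
    have k1 : 0 <= 2^-1 / (2 / D) * k x by rewrite mulr_ge0// divr_ge0// ltW.
    have k2 : 0 <= 2^-1 * (2 / D) * W x ^+ 2 by rewrite mulr_ge0 ?sqr_ge0// mulr_ge0// ltW.
    lra.
  have [h|h] := leP (M / 2 ^+ m) (f x); first by have := W_in h; lra.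
  (* AM-GM: [- W x <= D / 4 + W x ^+ 2 / D] *)
  rewrite k_out// => _.
  have e1 : 2^-1 / (2 / D) * 1 = D / 4 by field; exact: lt0r_neq0.
  have e2 : 2^-1 * (2 / D) * W x ^+ 2 = W x ^+ 2 / D by field; exact: lt0r_neq0.
  rewrite e1 e2.
  have : 0 <= (W x + D / 2) ^+ 2 / D by rewrite divr_ge0 ?sqr_ge0// ltW.
  have -> : (W x + D / 2) ^+ 2 / D = W x ^+ 2 / D + W x + D / 4 by field; exact: lt0r_neq0.
  lra.
exists P => //; apply: (le_trans hP).
have -> : 2^-1 / (2 / D) * a = D * a / 4 by field; exact: lt0r_neq0.
have h1 : D * a <= 2 / D.
  rewrite -(ler_pM2l D0) in ha; apply: (le_trans ha).
  by rewrite le_eqVlt; apply/orP; left; apply/eqP; field; exact: lt0r_neq0.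
have h2 : r ^+ 2 <= 1.
  rewrite -r2 -[leLHS]mul1r ler_wpM2r ?sqr_ge0//; have := N1; rewrite /N; lra.
have h3 : 2^-1 * (2 / D) * (r ^+ 2 + 1) <= 2 / D.
  have -> : 2^-1 * (2 / D) * (r ^+ 2 + 1) = (r ^+ 2 + 1) * D^-1 by field; exact: lt0r_neq0.
  rewrite ler_wpM2r ?invr_ge0 ?(ltW D0)//; lra.
have -> : 4 / D = 2 * (2 / D) by field; exact: lt0r_neq0.
lra.
Qed.

(* Contracting towards [x1] by [d = 1 / (164 n)] loses only constant factors and
   raises [W] by [d * W x1] on K. *)
Let W_bound P : has_int (lam n) (fun x => Wp x * f x) P ->
  forall x1, M / 2 ^+ m <= f x1 -> W x1 <= 1312 * N * P.
Proof.
move=> IP x1 hx1; have [a Ia ha] := Ik.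
have D0 : 0 < D := two_pos _.
have m0 : (0 : R) < m%:R by rewrite ltr0n /m muln_gt0.
pose d : R := (2 * m%:R)^-1.
have mE : m%:R = 82 * N by rewrite /m natrM.
have d0 : 0 < d by rewrite invr_gt0 mulr_gt0.
have dN : 164 * N * d = 1.
  by rewrite /d mE; field; have := N1; move=> h; apply: lt0r_neq0; lra.
have nd : N * d = 164^-1 by move: dN; lra.
have d1 : d <= 164^-1.
  by rewrite -nd -[leLHS]mul1r ler_wpM2r ?N1// ltW.
have md : 1 - m%:R * d = 2^-1 by rewrite mE -mulrA nd; lra.
have g0 z : 0 <= Wp z * f z by rewrite mulr_ge0// le_max lexx orbT.
have Wx1 := W_in hx1.
have hd : 0 < 1 - d by lra.
have IL := has_int_affine (d *: x1) hd g0 IP.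
have IR := has_intZ (d * W x1 / 2) (has_intD If (has_intZ (-1) Ia)).
(* Here [1 - a] is the mass of K; off K the left integrand vanishes. *)
have key : d * W x1 / 2 * (1 + (-1) * a) <= (1 - d)^-1 ^+ n * P.
  apply: (has_int_le IR IL) => x.
  have [h|h] := leP (M / 2 ^+ m) (f x); last first.
    rewrite k_out// mulN1r mul1r subrr mulr0.
    exact: g0.
  rewrite k_in// mul0r mulr0 addr0.
  have d01 : 0 <= d <= 1 by apply/andP; split; lra.
  have := logconcave_contract f0 lc M0 (fM x) hx1 d01; rewrite -/m md => hc.
  have Wz : d * W x1 <= Wp ((1 - d) *: (x : 'rV[R]_n) + d *: x1).
    rewrite /Wp le_max; apply/orP; left; rewrite /W !dotE.
    have := W_in h; rewrite /W; nra.
  apply: (@le_trans _ _ (d * W x1 * (f x * 2^-1))); first lra.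
  apply: ler_pM => //; first by rewrite mulr_ge0// ltW.
  by rewrite mulr_ge0.
have P0 : 0 <= P := has_int_ge0 IP g0.
have hn : (1 - d)^-1 ^+ n <= 2.
  have hB : 2^-1 <= (1 - d) ^+ n.
    have d01 : 0 <= d <= 1 by apply/andP; split; lra.
    have hB := bernoulli_ineq n d01.
    by apply: le_trans hB; rewrite -/N nd; lra.
  rewrite exprVn -[leRHS]invrK lef_pV2// ?posrE ?exprn_gt0//.
have a2 : a <= 2^-1.
  apply: (le_trans ha); rewrite ler_pdivrMr ?exprn_gt0//.
  have := D_ge; have := N1; nra.
have h1 : d * W x1 / 4 <= 2 * P.
  apply: (@le_trans _ _ (d * W x1 / 2 * (1 + -1 * a))).
    have : 0 <= d * W x1 by rewrite mulr_ge0// ltW.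
    nra.
  by apply: (le_trans key); rewrite ler_wpM2r.
have h2 : d * W x1 <= 8 * P by lra.
have NN : 0 <= 164 * N by have := N1; lra.
have := ler_wpM2l NN h2; rewrite mulrA dN mul1r; lra.
Qed.

(** On K, [W] is at most [L], so the second moment [r ^+ 2 + 1] is at most [L * P + b]. The constant
    in [r2] makes [L * (2 * r)] equal to 1/4, and [b] is at most 1/4 as well. *)
Lemma width_contradiction : False.
Proof.
have [P IP hP] := IWp; have [b Ib hb] := IkW; have WP := W_bound IP.
have D0 : 0 < D := two_pos _.
have g0 z : 0 <= Wp z * f z by rewrite mulr_ge0// le_max lexx orbT.
have P0 : 0 <= P := has_int_ge0 IP g0.
have rN : 128 * 164 * N * r ^+ 2 = 1 := r2.
have P2 : P <= 2 * r.
  suff : 4 / D <= r by lra.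
  have hD : 1000 * N <= D by have := D_ge; have := N1; lra.
  (* By [r2], [a ^+ 2] is about 47 [N], hence [a >= 4]; since [D >= 1000 * N], this gives
     [4 / D <= r]. *)
  pose a := r * (1000 * N).
  have aD : a <= r * D by rewrite ler_wpM2l// ltW.
  have a0 : 0 <= a.
    by apply: mulr_ge0; [exact: ltW|apply: mulr_ge0; exact: ler0n].
  have aa : a ^+ 2 = 1000 * 1000 / (128 * 164) * N * (128 * 164 * N * r ^+ 2).
    by rewrite /a; field.
  rewrite rN mulr1 in aa.
  have a4 : 4 <= a.
    rewrite leNgt; apply/negP => a4.
    have : a ^+ 2 <= 4 * 4 by rewrite expr2; apply: ler_pM => //; exact: ltW.
    by rewrite aa; have := N1; lra.
  by rewrite ler_pdivrMr; [exact: le_trans a4 aD|].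
have hx0 : M / 2 ^+ m <= f x0.
  rewrite ler_pdivrMr//; have : (2 : R) <= 2 ^+ m.
    by rewrite -[leLHS]expr1 ler_eXn2l// ?ltr1n// /m muln_gt0.
  have := fx0; have := f0 x0; nra.
pose L := 2624 * N * r.
have L0 : 0 <= L.
  by apply: mulr_ge0; [apply: mulr_ge0; exact: ler0n|exact: ltW].
have WL x1 : M / 2 ^+ m <= f x1 -> W x1 <= L.
  move=> h; apply: (le_trans (WP _ h)); rewrite /L.
  have := N1; nra.
have hL : r ^+ 2 + 1 <= L * P + b.
  apply: (has_int_le IW2 (has_intD (has_intZ L IP) Ib)) => x.
  rewrite mulrA -mulrDl ler_wpM2r//.
  have [h|h] := leP (M / 2 ^+ m) (f x).
    rewrite k_in// mul0r addr0 /Wp.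
    by rewrite max_l ?W_in// expr2 ler_wpM2r ?W_in// WL.
  rewrite k_out// mul1r lerDr mulr_ge0// le_max lexx orbT//.
have LP : L * P <= 4^-1.
  apply: (@le_trans _ _ (L * (2 * r))); first by rewrite ler_wpM2l.
  have -> : L * (2 * r) = 4^-1 * (128 * 164 * N * r ^+ 2) by rewrite /L; field.
  by rewrite rN mulr1.
have Wx2 : W x0 ^+ 2 <= 328 * N.
  apply: (@le_trans _ _ (L ^+ 2)).
    by rewrite ler_pXn2r ?nnegrE ?W_in ?WL.
  have -> : L ^+ 2 = 328 * N * (128 * 164 * N * r ^+ 2) by rewrite /L; ring.
  by rewrite rN mulr1.
have r1 : r ^+ 2 <= 1.
  by rewrite -rN -[leLHS]mul1r ler_wpM2r ?sqr_ge0//; have := N1; lra.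
have hb4 : b <= 4^-1.
  apply: (le_trans hb); rewrite mulrAC ler_pdivrMr ?exprn_gt0//.
  have := D_ge; have := N1; nra.
have := sqr_ge0 r; lra.
Qed.

End width.

(** * Finitely many directions *)

Section directions.
Context {R : realType} {n : nat}.

Lemma sphere_compact : compact [set u : 'rV[R]_n | dot u u = 1].
Proof.
have cbox : compact [set v : 'rV[R]_n | forall i, v ord0 i \in `[(-1 : R), 1]].
  apply: (@rV_compact _ _ (fun=> `[(-1 : R), 1]%classic)) => _.
  exact: segment_compact.
apply: (subclosed_compact _ cbox).
  rewrite (_ : [set u | _] = (fun u : 'rV[R]_n => dot (0 - u) (0 - u)) @^-1` [set 1]); last first.
    by apply/seteqP; split => u /=; rewrite sub0r dotNl dotNr opprK.
  apply: closed_comp; last exact: closed_eq.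
  by move=> u _; exact: dist2_continuous.
move=> u /= u1 i; rewrite in_itv/= -ler_norml -(@ler_pXn2r _ 2) ?nnegrE// expr1n.
rewrite real_normK ?num_real// -u1 /dot (bigD1 i)//= -expr2 lerDl.
by apply: sumr_ge0 => j _; rewrite -expr2 sqr_ge0.
Qed.

(** The open sets {u : r < dot u q}, for [q] in K, cover the compact unit sphere; homogeneity passes
    from unit vectors to all [g]. *)
Lemma finite_directions (K : set 'rV[R]_n) (r : R) : (0 < n)%N ->
  (forall u, dot u u = 1 -> exists2 q, K q & r < dot u q) ->
  exists2 S : seq 'rV[R]_n, (forall q, q \in S -> K q) &
    forall g, exists2 q, q \in S & r * enorm g <= dot g q.
Proof.
move=> n0 hK; have := sphere_compact; rewrite compact_cover.
move=> /(_ _ K (fun q => [set u | r < dot u q])) [].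
- move=> q _; rewrite (_ : [set u | _] = (fun u : 'rV[R]_n => dot u q) @^-1` [set x | r < x]) //.
  apply: open_comp; last exact: open_gt.
  move=> u _; apply: continuous_sum_fun => i y.
  apply: continuousM; [exact: coord_continuous|exact: cst_continuous].
- by move=> u /= /hK[q Kq rq]; exists q.
move=> D DK cov; exists (enum_fset D) => [q qD|g]; first exact/set_mem/DK.
(* For [g = 0] any member of the finite set works; one exists because the sphere is nonempty when
   [n > 0]. *)
have [->|g0] := eqVneq g 0.
  pose w : 'rV[R]_n := delta_mx ord0 (Ordinal n0).
  have w1 : dot w w = 1.
    rewrite /dot (bigD1 (Ordinal n0))//= big1 ?addr0 ?mxE ?eqxx ?mulr1// => i i0.
    by rewrite mxE (negbTE i0) andbF mul0r.
  have [q qD _] := cov _ w1; exists q => //.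
  by rewrite enormE !dot0l sqrtr0 mulr0.
have eg : 0 < enorm g by rewrite enorm_gt0.
have g1 : dot ((enorm g)^-1 *: g) ((enorm g)^-1 *: g) = 1.
  by rewrite dotZl dotZr -sqr_enorm; field; exact: lt0r_neq0.
have [q qD /=] := cov _ g1; rewrite dotZl mulrC ltr_pdivlMr// => rq.
by exists q => //; exact: ltW.
Qed.

(* A convex set which is wide in every direction has points close to the origin:
   any other point could be moved towards one of the finitely many [q]. *)
Lemma convex_near_origin (K : set 'rV[R]_n) (S : seq 'rV[R]_n) (r : R) :
  convex_set_rV K -> 0 <= r -> (forall q, q \in S -> K q) ->
  (forall g, exists2 q, q \in S & r * enorm g <= dot g q) ->
  forall e, 0 < e -> exists2 p, K p & dot p p < e.
Proof.
move=> cK r0 SK hS e e0.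
have [q0 q0S _] := hS 0.
have [qm qmS hqm] := seq_argmax (fun q => dot q q) q0S.
pose L := dot qm qm.
have L0 : 0 <= L by exact: dot_ge0.
pose B := [set x | exists2 p, K p & x = dot p p].
have Binf : has_inf B.
  split; first by exists (dot q0 q0); exists q0 => //; exact: SK.
  by exists 0 => _ [p _ ->]; exact: dot_ge0.
suff B0 : inf B <= 0.
  have [_ [p Kp ->] pe] := inf_lt Binf.1 (le_lt_trans B0 e0).
  by exists p.
rewrite leNgt; apply/negP => m0.
set m := inf B in m0.
have mL : 0 < m + L by rewrite ltr_pwDl.
(* Near-minimizer of t^2 L + (1 - t)^2 m. As [dot p p < m + t * m] and [dot p q <= 0], the moved
   point has squared norm below m (1 - 2 t^2 + t^3), hence below the infimum [m]. *)
pose t := m / (m + L).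
have t0 : 0 < t by rewrite divr_gt0.
have t1 : t <= 1 by rewrite ler_pdivrMr// mul1r lerDl.
have m1 : m < m + t * m by rewrite ltrDl mulr_gt0.
have [_ [p Kp ->] pm] := inf_lt Binf.1 m1.
have [q qS hq] := hS (- p).
have pq : dot p q <= 0.
  have : 0 <= dot (- p) q by apply: le_trans hq; rewrite mulr_ge0// enorm_ge0.
  by rewrite dotNl oppr_ge0.
have Kp' : K (t *: q + (1 - t) *: p).
  by apply: cK => //; [exact: SK|rewrite (ltW t0)].
have : m <= dot (t *: q + (1 - t) *: p) (t *: q + (1 - t) *: p).
  by apply: (ge_inf Binf.2); exists (t *: q + (1 - t) *: p).
rewrite !dotE (dotC q p) leNgt => /negP; apply.
have qL : dot q q <= L := hqm _ qS.
have tE : t * (m + L) = m by rewrite /t; field; exact: lt0r_neq0.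
have t0' := ltW t0; have t1' : 0 <= 1 - t by rewrite subr_ge0.
have s1 : (1 - t) * (1 - t) * dot p p <= (1 - t) * (1 - t) * (m + t * m).
  by apply: ler_wpM2l; [exact: mulr_ge0|exact: ltW].
have s2 : t * t * dot q q <= t * t * L by apply: ler_wpM2l => //; exact: mulr_ge0.
have s3 : t * (1 - t) * dot p q <= 0 by apply: mulr_ge0_le0 => //; exact: mulr_ge0.
have s4 : t * t * L = t * m - t * t * m by have /= := congr1 (fun z => t * z) tE; lra.
have s5 : 0 < t * t * m by apply: mulr_gt0 => //; exact: mulr_gt0.
have s6 : 0 <= t * t * m * (1 - t) by apply: mulr_ge0 => //; exact: ltW.
lra.
Qed.

End directions.

(** * The perimeter bound *)

Section min_translates.
Context {R : realType} {n : nat} (f : rVb R n -> R).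
Implicit Types S : seq 'rV[R]_n.

Definition min_translates S (y : rVb R n) : R :=
  foldr (fun s v => Num.min (f ((y : 'rV[R]_n) + s)) v) (f y) S.

Lemma min_translates_le S y : min_translates S y <= f y.
Proof. by elim: S => //= s S IH; rewrite ge_min IH orbT. Qed.

Lemma min_translates_mem S s (y : 'rV[R]_n) : s \in S -> min_translates S y <= f (y + s).
Proof.
elim: S => //= a S IH; rewrite inE ge_min => /orP[/eqP ->|/IH ->]; first by rewrite lexx.
by rewrite orbT.
Qed.

Lemma min_translates_ge S (y : 'rV[R]_n) v : v <= f y -> (forall s, s \in S -> v <= f (y + s)) ->
  v <= min_translates S y.
Proof.
move=> vy; elim: S => //= a S IH h; rewrite le_min h ?mem_head//=.
by apply: IH => s sS; apply: h; rewrite inE sS orbT.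
Qed.

Lemma measurable_min_translates S : measurable_fun setT f ->
  measurable_fun setT (min_translates S).
Proof.
move=> mf; elim: S => [|s S IH] //=.
by apply: measurable_minr => //; exact: measurable_translate.
Qed.

End min_translates.

Section perimeter_bound.
Context {R : realType} {n : nat} (f : rVb R n -> R).
Hypothesis n0 : (0 < n)%N.
Hypothesis f0 : forall x, 0 <= f x.
Hypothesis If : has_int (lam n) f 1.
Hypothesis lc : forall (x y : 'rV[R]_n) t, 0 <= t <= 1 ->
  f x `^ t * f y `^ (1 - t) <= f (t *: x + (1 - t) *: y).
Hypothesis Iu : forall u, has_int (lam n) (fun x : rVb R n => dot u x * f x) 0.
Hypothesis Iu2 : forall u,
  has_int (lam n) (fun x : rVb R n => dot u x ^+ 2 * f x) (dot u u).

Let mf : measurable_fun setT f := has_int_measurable If.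

(** Contracting [x] by [d] towards [p] and then adding [e *: s] amounts to contracting [x] by [d]
    towards [q]. Thus [h] at the contracted point keeps the fraction 1 - 82 n d of [f x], and the
    change of variables costs another n d. *)
Lemma outer_mass_linear (r : R) (A : set 'rV[R]_n) (e : R) :
  0 < r -> 128 * 164 * n%:R * r ^+ 2 = 1 -> convex_body A -> 0 < e ->
  2 * (82 * n%:R) * e <= r ->
  (dmeasure f (parallel_body A e `\` A) <= (166 * n%:R / r * e)%:E)%E.
Proof.
move=> r0 r2 [cA convA Ai] e0 er.
have A0 : A !=set0 by have [a /interior_subset Aa] := Ai; exists a.
have [B fB] := logconcave_bounded f0 If lc.
pose M := sup (range f).
have supf : has_sup (range f).
  by split; [exists (f 0); exists 0|exists B => _ [x _ <-]].
have fM x : f x <= M by apply: (sup_upper_bound supf); exists x.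
have M0 : 0 < M.
  rewrite ltNge; apply/negP => M0.
  have : (1 : R) <= 0 by apply: (has_int_le If (has_int0 (lam n))) => x; exact: le_trans M0.
  by rewrite ler10.
(* The supremum need not be attained; a point above half of it suffices. *)
have [x0 fx0] : exists x0, M < 2 * f x0.
  have : M / 2 < sup (range f) by rewrite -/M; lra.
  by move=> /(sup_gt supf.1)[_ [x0 _ <-] h]; exists x0; lra.
pose K := [set q : 'rV[R]_n | M / 2 ^+ (82 * n) <= f q].
have cK : convex_set_rV K.
  move=> x y t Kx Ky t01; rewrite /K/=; apply: le_trans (lc x y t01).
  have /andP[t0 t1] := t01; set c := M / _.
  have c0 : 0 < c by rewrite divr_gt0// exprn_gt0.
  have -> : c = c `^ t * c `^ (1 - t).
    by rewrite -powRD ?(lt0r_neq0 c0) ?implybT// addrC subrK powRr1// ltW.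
  apply: ler_pM; rewrite ?powR_ge0//; apply: ge0_ler_powR; rewrite ?nnegrE ?(ltW c0) ?subr_ge0//.
have wide u : dot u u = 1 -> exists2 q, K q & r < dot u q.
  move=> u1; apply: contrapT => hn.
  have I2 := Iu2 u; rewrite u1 in I2.
  apply: (@width_contradiction R n f n0 f0 If lc M x0 u r) => // q Kq.
  by rewrite leNgt; apply/negP => rq; apply: hn; exists q.
have [S0 S0K hS0] := finite_directions n0 wide.
have r24 : 0 < r ^+ 2 / 4 by rewrite divr_gt0// exprn_gt0.
have [p Kp pr] := convex_near_origin cK (ltW r0) S0K hS0 r24.
have enp : enorm p <= r / 2.
  have r20 : 0 <= r / 2 by rewrite divr_ge0// ltW.
  rewrite -(@ler_pXn2r _ 2) ?nnegrE ?enorm_ge0// sqr_enorm.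
  have -> : (r / 2) ^+ 2 = r ^+ 2 / 4 by field.
  exact: ltW.
(* Recentring at [p] costs at most [r / 2] of the width [r]; the factor [2 / r] normalizes the rest
   to 1. *)
pose S := [seq (2 / r) *: (q - p) | q <- S0].
have HS g : exists2 s, s \in S & enorm g <= dot g s.
  have [q qS hq] := hS0 g; exists ((2 / r) *: (q - p)); first exact: map_f.
  rewrite !dotE; have := dot_le_enorm g p.
  have : enorm g * enorm p <= enorm g * (r / 2) by rewrite ler_wpM2l// enorm_ge0.
  move=> h1 h2; have h3 : r / 2 * enorm g <= dot g q - dot g p by lra.
  have -> : enorm g = 2 / r * (r / 2 * enorm g) by field; exact: lt0r_neq0.
  by rewrite ler_wpM2l// divr_ge0// ltW.
(* Chosen so that [e *: s] equals [d *: (q - p)]. *)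
pose d := 2 / r * e.
have d0 : 0 < d by rewrite mulr_gt0// divr_gt0.
have rd : r * d = 2 * e by rewrite /d; field; exact: lt0r_neq0.
have nR : 1 <= (n%:R : R) by rewrite ler1n.
have md : (82 * n)%:R * d <= 1.
  rewrite natrM -(ler_pM2l r0) mulr1; apply: le_trans er.
  by rewrite le_eqVlt; apply/orP; left; apply/eqP; rewrite mulrCA rd; ring.
have d1 : d < 1.
  have : 82 * d <= (82 * n)%:R * d.
    by rewrite natrM ler_wpM2r ?(ltW d0)//; lra.
  lra.
have d01 : 0 <= d <= 1 by apply/andP; split; lra.
pose h := min_translates f [seq e *: s | s <- S].
have h0 x : 0 <= h x by apply: min_translates_ge.
have [|x|v Ih vle1] := has_int_dom _ If (g := h).
- exact: measurable_min_translates.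
- by rewrite h0 min_translates_le.
have hcontr (x : 'rV[R]_n) :
    (1 - (82 * n)%:R * d) * f x <= h ((1 - d) *: x + d *: p).
  rewrite mulrC; apply: min_translates_ge.
    exact: (logconcave_contract f0 lc M0 (fM x) Kp d01).
  move=> _ /mapP[_ /mapP[q qS ->] ->].
  have -> : (1 - d) *: x + d *: p + e *: (2 / r *: (q - p)) = (1 - d) *: x + d *: q.
    by apply/rowP => i; rewrite !mxE /d; field; exact: lt0r_neq0.
  exact: (logconcave_contract f0 lc M0 (fM x) (S0K _ qS) d01).
have dd : 0 < 1 - d by lra.
have := has_int_le (has_intZ (1 - (82 * n)%:R * d) If) (has_int_affine (d *: p) dd h0 Ih) hcontr.
rewrite mulr1 exprVn ler_pdivlMl ?exprn_gt0// => hv.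
have hB := bernoulli_ineq n d01.
have hv2 : 1 - 83 * n%:R * d <= v.
  apply: le_trans hv.
  have md' : 0 <= 1 - (82 * n)%:R * d by rewrite subr_ge0.
  apply: (@le_trans _ _ ((1 - n%:R * d) * (1 - (82 * n)%:R * d))); last by rewrite ler_wpM2r.
  rewrite natrM.
  have : 0 <= n%:R * d * (82 * n%:R * d).
    by apply: mulr_ge0; apply: mulr_ge0; rewrite ?(ltW d0)//; lra.
  lra.
have hf x : h x <= f x by exact: min_translates_le.
have hfS (x : 'rV[R]_n) s : s \in S -> h x <= f (x + e *: s).
  by move=> sS; apply: min_translates_mem; exact: (map_f (fun s => e *: s)).
have := outer_mass_le HS A0 cA convA e0 mf f0 h0 hf hfS.
rewrite Ih.2 If.2 -leeBrDr// -EFinB => /le_trans; apply; rewrite lee_fin.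
have -> : 166 * n%:R / r * e = 83 * n%:R * d by rewrite /d; field; exact: lt0r_neq0.
lra.
Qed.

End perimeter_bound.

(** Expansion in coordinates turns the barycenter and covariance conditions into moments along every
    direction [u]. *)
Lemma isotropic_moments (R : realType) n (f : 'rV[R]_n -> R) :
  measurable_fun [set: rVb R n] f -> isotropic_density f -> forall u : 'rV[R]_n,
  has_int (lam n) (fun x : rVb R n => dot u x * f x) 0 /\
  has_int (lam n) (fun x : rVb R n => dot u x ^+ 2 * f x) (dot u u).
Proof.
move=> mf [i1 i2] u.
have mc (i : 'I_n) := coord_measurable (R := R) i.
split.
  have := @has_int_sum _ _ _ (lam n) _ (index_enum 'I_n)
    (fun i (x : rVb R n) => u ord0 i * ((x : 'rV[R]_n) ord0 i * f x)) (fun i => u ord0 i * 0).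
  rewrite big1; last by move=> i _; rewrite mulr0.
  move=> H; apply: has_int_ext (H _) => [x|i].
    by rewrite /dot mulr_suml; apply: eq_bigr => i _; rewrite mulrA.
  by apply: has_intZ; apply: sint_has_int (i1 i); exact: measurable_funM.
have H := @has_int_sum _ _ _ (lam n) _ (index_enum 'I_n)
  (fun i (x : rVb R n) => \sum_(j < n) u ord0 i * u ord0 j *
     ((x : 'rV[R]_n) ord0 i * (x : 'rV[R]_n) ord0 j * f x))
  (fun i => \sum_(j < n) u ord0 i * u ord0 j * (i == j)%:R).
have -> : dot u u = \sum_(i < n) \sum_(j < n) u ord0 i * u ord0 j * (i == j)%:R.
  apply: eq_bigr => i _; rewrite (bigD1 i)//= eqxx mulr1 big1 ?addr0// => j ji.
  by rewrite eq_sym (negbTE ji) mulr0.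
apply: has_int_ext (H _) => [x|i].
  rewrite expr2 {1}/dot mulr_suml mulr_suml; apply: eq_bigr => i _.
  rewrite /dot mulr_sumr mulr_suml; apply: eq_bigr => j _; ring.
apply: has_int_sum => j; apply: has_intZ; apply: sint_has_int (i2 i j).
by do 2 apply: measurable_funM => //.
Qed.

Theorem theorem1p1 (R : realType) :
  exists C : R, 0 < C /\
    forall (n : nat) (f : 'rV[R]_n -> R),
      (1 <= n)%N ->
      borel_fun f ->
      logconcave_prob_density f ->
      isotropic_density f ->
      (Gamma f <= (C * n%:R `^ (3 / 2))%:E)%E.
Proof.
pose c : R := Num.sqrt (128 * 164).
have c2 : c ^+ 2 = 128 * 164 by apply: sqr_sqrtr; apply: mulr_ge0; exact: ler0n.
have c0 : 0 < c by rewrite sqrtr_gt0; apply: mulr_gt0; rewrite ltr0n.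
exists (166 * c); split; first by apply: mulr_gt0 => //; rewrite ltr0n.
move=> n f n1 /borel_fun_measurable mf [f0 f1 lc] iso.
have nR : 0 < (n%:R : R) by rewrite ltr0n.
have If : has_int (lam n) f 1.
  have I1 : (\int[lam n]_x (f x)%:E = 1)%E.
    by rewrite -iintE//; exact/measurable_EFinP.
  split => //; apply/integrableP; split; first exact/measurable_EFinP.
  under eq_integral do rewrite /= ger0_norm//.
  by rewrite I1 ltry.
have mom := isotropic_moments mf iso.
pose s : R := Num.sqrt n%:R.
have s0 : 0 < s by rewrite sqrtr_gt0.
have s2 : s ^+ 2 = n%:R by rewrite sqr_sqrtr// ltW.
(* The solution of the width equation [r2]; it turns the slope [166 * n%:R / r] into a multiple of
   n^(3/2). *)
pose r := (c * s)^-1.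
have r0 : 0 < r by rewrite invr_gt0 mulr_gt0.
have r2 : 128 * 164 * n%:R * r ^+ 2 = 1.
  by rewrite -c2 -s2 /r; field; rewrite !lt0r_neq0.
have CE : 166 * c * n%:R `^ (3 / 2) = 166 * n%:R / r.
  have -> : 3 / 2 = 1 + 2^-1 :> R by field.
  rewrite powRD ?(lt0r_neq0 nR) ?implybT// powRr1 ?(ltW nR)// powR12_sqrt ?(ltW nR)// -/s /r.
  by rewrite invrK; ring.
rewrite CE; apply: ge_ereal_sup => _ [A cA <-].
apply: ge_ereal_sup => _ [d d0 <-]; rewrite /= in d0.
(* The perimeter is a supremum over [d] of infima over [e < d], so one admissible [e] below each [d]
   is enough; [q] is the largest [e] allowed by [outer_mass_linear]. *)
pose q := r / (2 * (82 * n%:R)).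
have N0 : 0 < 2 * (82 * n%:R) :> R by apply: mulr_gt0 => //; apply: mulr_gt0.
have q0 : 0 < q by rewrite divr_gt0.
pose e := Num.min (d / 2) q.
have e0 : 0 < e by rewrite lt_min q0 divr_gt0.
have ed : e < d by rewrite gt_min; apply/orP; left; lra.
have er : 2 * (82 * n%:R) * e <= r.
  by rewrite mulrC -ler_pdivlMr// /e ge_min lexx orbT.
apply: (@le_trans _ _ (dmeasure f (parallel_body A e `\` A) * (e^-1)%:E)%E).
  by apply: ereal_inf_lbound; exists e => //=; rewrite e0 ed.
have H := @outer_mass_linear R n f n1 f0 If lc (fun u => (mom u).1) (fun u => (mom u).2)
  r A e r0 r2 cA e0 er.
rewrite lee_pdivrMr//.
Qed.
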